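(* Let $V$ be a $\mathbb Z$-graded $R$-module and let $A,B,C$ be homogeneous cohomological fields on $V$. Suppose there is $\mathbf r\ge\mathbf 0$ in $\mathbb N^n$ such that for all $i=1,\dots,n$ $$(z_i-x_i)^{r_i}[A(\mathbf z),B(\mathbf x)]=(z_i-w_i)^{r_i}[A(\mathbf z),C(\mathbf w)]=(x_i-w_i)^{r_i}[B(\mathbf x),C(\mathbf w)]=0.$$ Then the following hold. (1) For all $i$ and all $\mathbf k\ge \mathbf 0$ we have $(z_i-w_i)^{3r_i}[A(\mathbf z),B(\mathbf w)_{(\mathbf k)}C(\mathbf w)]=0$. (2) Suppose further that the pairs $A,B$ and $A,C$ are mutually local, with $$[A(\mathbf z),B(\mathbf x)]=\sum_{\mathbf 0\le\mathbf m\le\mathbf r-\mathbf 1}\partial^{(\mathbf m)}_{\mathbf x}\Delta(\mathbf z,\mathbf x)D^{\mathbf m}(\mathbf x),\qquad [A(\mathbf z),C(\mathbf w)]=\sum_{\mathbf 0\le\mathbf m\le\mathbf r-\mathbf 1}\partial^{(\mathbf m)}_{\mathbf w}\Delta(\mathbf z,\mathbf w)E^{\mathbf m}(\mathbf w).$$ Then the pair $A(\mathbf z)$ and $:\!BC\!:(\mathbf w)$ is mutually local, with commutator $$[A(\mathbf z),:\!BC\!:(\mathbf w)]=\sum_{\mathbf 0\le\mathbf m\le\mathbf r-\mathbf 1}\partial^{(\mathbf m)}_{\mathbf w}\Delta(\mathbf z,\mathbf w)\Big(:\!D^{\mathbf m}C\!:(\mathbf w)+(-1)^{p(B)(p(A)+N)}:\!BE^{\mathbf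 m}\!:(\mathbf w)\Big).$$
   Context: Fix a commutative ring $R$ and integers $N,n$ with $n\ge1$; $\mathbb N=\{0,1,2,\dots\}$. Bold letters are $n$-tuples: variables $\mathbf z=(z_1,\dots,z_n)$, multi-indices in $\mathbb N^n$; $\mathbf 0,\mathbf 1$ are constant tuples; $\mathbf k\ge\mathbf j$ is componentwise; $|\mathbf k|=\sum k_i$; $\mathbf z^{\mathbf k}=\prod z_i^{k_i}$; $\binom{\mathbf k}{\mathbf j}=\prod\binom{k_i}{j_i}$. For a $\mathbb Z$-graded $R$-module, $p(a)$ is the degree of a homogeneous element and $p(a,b)=(-1)^{p(a)p(b)}$. Formal calculus. $\mathcal K^{\mathbf z}_{\mathrm{dist}}(V)$ is the graded $R$-module of series $A(\mathbf z)=\sum_{\mathbf k\ge\mathbf 0}(\mathbf z^{\mathbf k}A_{-\mathbf 1-\mathbf k}+\Omega^{\mathbf k}_{\mathbf z}A_{\mathbf k})$ with coefficients in $V$, where the $z_i$ have degree $0$ and the symbols $\Omega_{\mathbf z}^{\mathbf k}$ have degree $N$; $V\langle\!\langle\mathbf z\rangle\!\rangle$ is the submodule of series for which there is $\mathbf K$ with $A_{\mathbf k}=0$ unless $\mathbf k\le\mathbf K$. Write $A_+=\sum\mathbf z^{\mathbf k}A_{-\mathbf 1-\mathbf k}$, $A_-=\sum\Omega^{\mathbf k}_{\mathbf z}A_{\mathbf k}$. $\mathcal K^{\mathbf z,\mathbf w}_{\mathrm{dist}}(V)$ consists of all formal series in $\mathbf z^{\mathbf j}\mathbf w^{\mathbf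 k}$, $\mathbf z^{\mathbf j}\Omega^{\mathbf k}_{\mathbf w}$, $\mathbf w^{\mathbf j}\Omega^{\mathbf k}_{\mathbf z}$, $\Omega^{\mathbf j}_{\mathbf z}\Omega^{\mathbf k}_{\mathbf w}$ (similarly for more variables). Products (when no infinite sums of coefficients occur) are given by $\mathbf z^{\mathbf j}\Omega^{\mathbf k}_{\mathbf z}=\Omega^{\mathbf k-\mathbf j}_{\mathbf z}$ if $\mathbf k\ge\mathbf j$ and $0$ otherwise, $\Omega^{\mathbf j}_{\mathbf z}\Omega^{\mathbf k}_{\mathbf z}=0$, $\Omega^{\mathbf j}_{\mathbf z}\Omega^{\mathbf k}_{\mathbf w}=(-1)^N\Omega^{\mathbf k}_{\mathbf w}\Omega^{\mathbf j}_{\mathbf z}$, variables commute with everything, and a homogeneous coefficient $a$ satisfies $a\Omega=(-1)^{p(a)N}\Omega a$. Hasse derivatives: $\partial^{(\mathbf j)}_{\mathbf z}\mathbf z^{\mathbf k}=\binom{\mathbf k}{\mathbf j}\mathbf z^{\mathbf k-\mathbf j}$, $\partial^{(\mathbf j)}_{\mathbf z}\Omega^{\mathbf k}_{\mathbf z}=(-1)^{|\mathbf j|}\binom{\mathbf k+\mathbf j}{\mathbf j}\Omega^{\mathbf k+\mathbf j}_{\mathbf z}$; in a product $\partial^{(\mathbf k)}FG$ the derivative acts on $F$ only. Residue: $\operatorname{Res}_{\mathbf z}(\mathbf z^{\mathbf j}f(\mathbf w))=0$, $\operatorname{Res}_{\mathbf z}(\Omega^{\mathbf j}_{\mathbf z}f(\mathbf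 w))=\delta_{\mathbf j,\mathbf 0}f(\mathbf w)$. $\Delta(\mathbf z,\mathbf w)=\sum_{\mathbf j\ge\mathbf 0}\big(\mathbf w^{\mathbf j}\Omega^{\mathbf j}_{\mathbf z}+(-1)^N\mathbf z^{\mathbf j}\Omega^{\mathbf j}_{\mathbf w}\big)$. Fields. A cohomological field on $V$ is $A(\mathbf z)=\sum_{\mathbf j}(\mathbf z^{\mathbf j}A_{(-\mathbf 1-\mathbf j)}+\Omega^{\mathbf j}_{\mathbf z}A_{(\mathbf j)})\in\mathcal K^{\mathbf z}_{\mathrm{dist}}(\operatorname{End}V)$ with $A(\mathbf z)v\in V\langle\!\langle\mathbf z\rangle\!\rangle$ for all $v\in V$; it is homogeneous of degree $p(A)$ if each $A_{(-\mathbf 1-\mathbf j)}$ has degree $p(A)$ and each $A_{(\mathbf j)}$ has degree $p(A)-N$. $[A(\mathbf z),B(\mathbf w)]=A(\mathbf z)B(\mathbf w)-p(A,B)B(\mathbf w)A(\mathbf z)$ is the graded commutator. A series $f(\mathbf z,\mathbf w)$ is local if $f=\sum_{\mathbf 0\le\mathbf j\le\mathbf K}\partial^{(\mathbf j)}_{\mathbf w}\Delta(\mathbf z,\mathbf w)g^{\mathbf j}(\mathbf w)$ for some $\mathbf K\in\mathbb N^n$, with $g^{\mathbf j}(\mathbf w)=\operatorname{Res}_{\mathbf z}((\mathbf z-\mathbf w)^{\mathbf j}f)$. Fields $A,B$ are mutually local if $[A(\mathbf z),B(\mathbf w)]\in\mathcal K^{\mathbf z,\mathbf w}_{\mathrm{dist}}(\operatorname{End}V)$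 is local. For $\mathbf k\ge\mathbf 0$, $A(\mathbf w)_{(\mathbf k)}B(\mathbf w)=\operatorname{Res}_{\mathbf z}\big((\mathbf z-\mathbf w)^{\mathbf k}[A(\mathbf z),B(\mathbf w)]\big)$. The normal ordered product is $:\!A(\mathbf z)B(\mathbf w)\!:=A(\mathbf z)_+B(\mathbf w)+p(A,B)B(\mathbf w)A(\mathbf z)_-$, and $:\!AB\!:(\mathbf z)$ is its value at $\mathbf w=\mathbf z$. *)

(* Defs.v *)
From HB Require Import structures.
From mathcomp Require Import all_boot all_order all_algebra.
From mathcomp Require Import boolp classical_sets functions cardinality fsbigop.
Set Implicit Arguments.
Unset Strict Implicit.
Unset Printing Implicit Defensive.
Import Order.TTheory GRing.Theory Num.Theory.
Local Open Scope classical_set_scope.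
Local Open Scope ring_scope.

Notation multi n := {ffun 'I_n -> nat}.

Section MultiIndex.
Variable n : nat.
Implicit Types j k : multi n.

Definition mi_le j k := [forall i, (j i <= k i)%N].
Definition mi_sub k j : multi n := [ffun i => (k i - j i)%N].
Definition mi_abs k := (\sum_(i < n) k i)%N.
Definition mi_binom k j := (\prod_(i < n) 'C(k i, j i))%N.
Definition mi_unit (i : 'I_n) : multi n := [ffun l => nat_of_bool (l == i)].

End MultiIndex.

(* [Pow j] is the symbol z^j and [Om j] the symbol Omega_z^j. *)
Inductive mono n := Pow of multi n | Om of multi n.

Definition mono_code n (x : mono n) : multi n + multi n :=
  match x with Pow j => inl j | Om j => inr j end.
Definition mono_decode n (c : multi n + multi n) : mono n :=
  match c with inl j => Pow j | inr j => Om j end.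
Lemma mono_codeK n : cancel (@mono_code n) (@mono_decode n).
Proof. by case. Qed.

HB.instance Definition _ n := Countable.copy (mono n) (can_type (@mono_codeK n)).

Definition one_mono n : mono n := Pow 0.

Definition is_Om n (x : mono n) : bool := if x is Om _ then true else false.

(* Number of Omega symbols in a monomial, as an integer. *)
Definition nOm n (x : mono n) : int := (is_Om x : nat)%:Z.

(* Product of two monomials in the same variables; [None] is the zero product. *)
Definition mono_mul n (x y : mono n) : option (mono n) :=
  match x, y with
  | Pow j, Pow k => Some (Pow (j + k))
  | Pow j, Om k | Om k, Pow j =>
      if mi_le j k then Some (Om (mi_sub k j)) else None
  | Om _, Om _ => None
  end.

(* K1 n E is K_dist^z(E): the series sum_mu mu * A mu, so that in the mode
   notation A (Pow j) = A_{-1-j} and A (Om j) = A_j.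
   K2 n E is K_dist^{z,w}(E): the series sum_{mu,nu} mu_z * nu_w * f mu nu;
   symbols in z are written to the left of symbols in w, and both to the left
   of the coefficients. *)
Definition K1 n (E : Type) := mono n -> E.
Definition K2 n (E : Type) := mono n -> mono n -> E.

Section LinearEndo.
Variables (R : comPzRingType) (V : lmodType R).

Definition End := {linear V -> V}.

Lemma endP (f g : End) : f =1 g -> f = g.
Proof.
case: f => f cf; case: g => g cg /= /funext efg; subst g; congr GRing.Linear.Pack.
case: cf => [[a1] [b1]]; case: cg => [[a2] [b2]].
by rewrite (Prop_irrelevance a1 a2) (Prop_irrelevance b1 b2).
Qed.

HB.instance Definition _ := gen_eqMixin End.
HB.instance Definition _ := gen_choiceMixin End.

Definition end_zero : End := \0.
Definition end_opp (f : End) : End := \- f.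
Definition end_add (f g : End) : End := f \+ g.
Definition end_scale (c : R) (f : End) : End := c \*: f.
Definition end_comp (f g : End) : End := f \o g.

Fact end_addA : associative end_add.
Proof. by move=> f g h; apply: endP => v /=; rewrite addrA. Qed.
Fact end_addC : commutative end_add.
Proof. by move=> f g; apply: endP => v /=; rewrite addrC. Qed.
Fact end_add0 : left_id end_zero end_add.
Proof. by move=> f; apply: endP => v /=; rewrite add0r. Qed.
Fact end_addN : left_inverse end_zero end_opp end_add.
Proof. by move=> f; apply: endP => v /=; rewrite addNr. Qed.

HB.instance Definition _ :=
  GRing.isZmodule.Build End end_addA end_addC end_add0 end_addN.

Fact end_scaleA a b f : end_scale a (end_scale b f) = end_scale (a * b) f.
Proof. by apply: endP => v /=; rewrite scalerA. Qed.
Fact end_scale1 : left_id 1 end_scale.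
Proof. by move=> f; apply: endP => v /=; rewrite scale1r. Qed.
Fact end_scaleDr : right_distributive end_scale +%R.
Proof. by move=> a f g; apply: endP => v /=; rewrite scalerDr. Qed.
Fact end_scaleDl f : {morph end_scale^~ f : a b / a + b}.
Proof. by move=> a b; apply: endP => v /=; rewrite scalerDl. Qed.

HB.instance Definition _ := GRing.Zmodule_isLmodule.Build R End
  end_scaleA end_scale1 end_scaleDr end_scaleDl.

(* The sum of a family of endomorphisms that is finite on every vector
   (0 when the family is not summable in this sense). *)
Definition end_sum (I : choiceType) (S : set I) (F : I -> End) : End :=
  xget 0 [set phi : End | forall v,
    finite_set (S `&` [set i | F i v != 0]) /\ phi v = \sum_(i \in S) F i v].

Lemma end_sumE (I : choiceType) (S : set I) (F : I -> End) :
  (forall v, finite_set (S `&` [set i | F i v != 0])) ->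
  forall v, end_sum S F v = \sum_(i \in S) F i v.
Proof.
move=> fin.
have lin : linear (fun v => \sum_(i \in S) F i v).
  move=> c u v.
  pose T := (S `&` [set i | F i u != 0]) `|` (S `&` [set i | F i v != 0])
    `|` (S `&` [set i | F i (c *: u + v) != 0]).
  have fT : finite_set T by rewrite !finite_setU.
  have w z : (S `&` [set i | F i z != 0]) `<=` T ->
      \sum_(i \in S) F i z = \sum_(i \in T) F i z.
    move=> sub; symmetry; apply: fsbig_widen; first by move=> i [[[]|[]]|[]].
    move=> i [Si nT] /=; apply/eqP; apply: contra_notT nT => h; exact: sub.
  have h1 : (S `&` [set i | F i u != 0]) `<=` T by move=> i ?; left; left.
  have h2 : (S `&` [set i | F i v != 0]) `<=` T by move=> i ?; left; right.
  have h3 : (S `&` [set i | F i (c *: u + v) != 0]) `<=` T by move=> i ?; right.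
  rewrite (w _ h1) (w _ h2) (w _ h3).
  rewrite !(fsbig_finite _ _ fT) /= scaler_sumr -big_split /=.
  by apply: eq_bigr => i _; rewrite linearP.
pose mL := GRing.isLinear.Build _ _ _ _ _ lin.
pose phi : End := HB.pack (fun v => \sum_(i \in S) F i v) mL.
by rewrite /end_sum; case: xgetP => [psi _ h v|/(_ phi)[]//]; case: (h v).
Qed.

End LinearEndo.

(* V is the direct sum of the submodules [piece a], a in Z. *)
Record grading (R : comPzRingType) (V : lmodType R) := Grading {
  piece :> int -> set V;
  piece0 : forall a, piece a 0;
  piece_lin : forall a c u v, piece a u -> piece a v -> piece a (c *: u + v);
  piece_dec : forall v, exists! s : int -> V,
    [/\ forall a, piece a (s a), finite_set [set a | s a != 0]
      & v = \sum_(a \in [set: int]) s a] }.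

Section Calculus.
Variables (R : comPzRingType) (n : nat) (N : int).

Definition zsign (e : int) : R := (-1) ^+ `|e|%N.

Definition in_z (E : nmodType) (A : K1 n E) : K2 n E :=
  fun x y => if y == one_mono n then A x else 0.
Definition in_w (E : nmodType) (B : K1 n E) : K2 n E :=
  fun x y => if x == one_mono n then B y else 0.

(* The product F G, where F is homogeneous of total degree p (z and w have
   degree 0 and Omega has degree N), so that the coefficient of mu_z nu_w in F
   has degree p - N (nOm mu + nOm nu).  The term
     (mu_z nu_w a) (mu'_z nu'_w b)
   is put in normal form by moving a past mu'_z nu'_w and nu_w past mu'_z.
   The sum is the junk value 0 when it is infinite. *)
Definition series_mul (E1 E2 : Type) (E3 : lmodType R) (op : E1 -> E2 -> E3)
    (p : int) (F : K2 n E1) (G : K2 n E2) : K2 n E3 :=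
  fun x y =>
  \sum_(q \in [set q : (mono n * mono n) * (mono n * mono n) |
          mono_mul q.1.1 q.2.1 = Some x /\ mono_mul q.1.2 q.2.2 = Some y])
    zsign ((p - N * (nOm q.1.1 + nOm q.1.2)) * N * (nOm q.2.1 + nOm q.2.2)
         + N * nOm q.1.2 * nOm q.2.1)
    *: op (F q.1.1 q.1.2) (G q.2.1 q.2.2).

Definition var_z (i : 'I_n) : K2 n R :=
  in_z (fun x => (x == Pow (mi_unit i))%:R).
Definition var_w (i : 'I_n) : K2 n R :=
  in_w (fun x => (x == Pow (mi_unit i))%:R).

(* (z_i - w_i)^r f *)
Definition zw_pow (E : lmodType R) (i : 'I_n) (r : nat) (f : K2 n E) : K2 n E :=
  iter r (series_mul *:%R 0 (var_z i - var_w i)) f.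

(* (z - w)^k f, k a multi-index *)
Definition zw_mpow (E : lmodType R) (k : multi n) (f : K2 n E) : K2 n E :=
  foldr (fun i g => zw_pow i (k i) g) f (enum 'I_n).

Definition Res_z (E : Type) (f : K2 n E) : K1 n E := f (Om 0).

(* The Hasse derivative with respect to w.  In the second case the binomial
   coefficient vanishes unless k >= j. *)
Definition hasse_w (j : multi n) (f : K2 n R) : K2 n R := fun x y =>
  match y with
  | Pow k => f x (Pow (k + j)) *+ mi_binom (k + j) j
  | Om k => (-1) ^+ mi_abs j * f x (Om (mi_sub k j)) *+ mi_binom k j
  end.

Definition Delta : K2 n R := fun x y =>
  match x, y with
  | Om j, Pow k => (j == k)%:R
  | Pow j, Om k => zsign N * (j == k)%:R
  | _, _ => 0
  end.

(* (hasse_w j Delta)(z,w) g(w); Delta is homogeneous of degree N. *)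
Definition dDelta_mul (E : lmodType R) (j : multi n) (g : K1 n E) : K2 n E :=
  series_mul *:%R N (hasse_w j Delta) (in_w g).

Definition is_local (E : lmodType R) (f : K2 n E) :=
  exists K : multi n,
    f = \sum_(j \in [set j | mi_le j K]) dDelta_mul j (Res_z (zw_mpow j f)).

Section Fields.
Variables (V : lmodType R) (G : grading V).

Definition has_degree (d : int) (phi : End V) :=
  forall a v, G a v -> G (a + d) (phi v).

Definition coh_field (A : K1 n (End V)) :=
  forall v, exists K, forall k, ~~ mi_le k K -> A (Om k) v = 0.

Definition homog (p : int) (A : K1 n (End V)) :=
  forall j, has_degree p (A (Pow j)) /\ has_degree (p - N) (A (Om j)).

Definition homog_field (p : int) (A : K1 n (End V)) :=
  coh_field A /\ homog p A.

End Fields.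

(* In what follows pA and pB are the degrees of A and B; they enter through
   the signs. *)
Section Operations.
Variable V : lmodType R.
Implicit Types (A B : K1 n (End V)) (pA pB : int).

(* A(z) B(w) and B(w) A(z), for A of degree pA and B of degree pB *)
Definition prod_zw pA A B : K2 n (End V) :=
  series_mul (@end_comp R V) pA (in_z A) (in_w B).
Definition prod_wz pB B A : K2 n (End V) :=
  series_mul (@end_comp R V) pB (in_w B) (in_z A).

(* [A(z), B(w)] *)
Definition field_comm pA pB A B : K2 n (End V) :=
  prod_zw pA A B - zsign (pA * pB) *: prod_wz pB B A.

Definition mutually_local pA pB A B :=
  [/\ coh_field A, coh_field B & is_local (field_comm pA pB A B)].

(* A(w)_(k) B(w) *)
Definition kprod pA pB (k : multi n) A B : K1 n (End V) :=
  Res_z (zw_mpow k (field_comm pA pB A B)).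

Definition plus_part A : K1 n (End V) := fun x => if is_Om x then 0 else A x.
Definition minus_part A : K1 n (End V) := fun x => if is_Om x then A x else 0.

(* :A(z)B(w): *)
Definition nop2 pA pB A B : K2 n (End V) :=
  prod_zw pA (plus_part A) B + zsign (pA * pB) *: prod_wz pB B (minus_part A).

(* f(z,z) *)
Definition restrict_diag (f : K2 n (End V)) : K1 n (End V) := fun x =>
  end_sum [set q : mono n * mono n | mono_mul q.1 q.2 = Some x]
          (fun q => f q.1 q.2).

(* :AB:(z) *)
Definition nop pA pB A B : K1 n (End V) := restrict_diag (nop2 pA pB A B).

End Operations.
End Calculus.

(* Main.v *)
Require Import Defs.
From mathcomp Require Import all_boot all_order all_algebra.
From mathcomp Require Import boolp classical_sets functions cardinality fsbigop.
From mathcomp Require Import zify.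

(** The signs of the theory are uniform: at monomials [x] in [z] and [y] in [w]
    the coefficient of [[A(z), B(w)]] is, up to a sign that depends only on which
    of [x], [y] are [Omega]'s, the graded commutator of the coefficients [A x] and
    [B y] ([field_commE]). Such signs do not affect vanishing, so they can be
    dropped and graded commutators treated as formal expressions subject to the
    Jacobi identity.

    Part (1) is Dong's lemma ([dong_commutator]). On the three-variable series
    [[A(z), [B(x), C(w)]]] one writes [(z_i - w_i)^(3r)] as
    [(z_i - w_i)^r ((z_i - x_i) + (x_i - w_i))^(2r)]. In the expansion of the
    second factor, terms with [(x_i - w_i)^r] vanish. The others contain
    [(z_i - x_i)^r], which kills the Jacobi summand [[[A, B], C]], while the first
    factor kills the other summand. The residue that defines [B_(k)C] commutes
    with all this.

    For part (2), [z_i - w_i] lowers the order of the derivatives of [Delta], so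
    taking residues against powers of [z - w] shows that a local expansion has
    unique coefficients ([Res_zw_mpow_dDelta]); in particular
    [D^m = A_(m)B] and [E^m = A_(m)C], which are again fields ([coh_kprod]).
    Also, a series that has the claimed form is local. To compute the
    commutator, write [:BC:] through the products of [B_+] with [C] and of [C_+]
    with [B] ([nopE]). Commuting with the coefficient [A x] is a derivation of
    these products ([gcomm_conv]), and by hypothesis it maps [B] to a sum of
    monomial multiples of the [D^m], and [C] to a sum of monomial multiples of
    the [E^m].

    If [x] is an [Omega], the multipliers are plain powers of [w] and can be
    moved out of the products; the claim follows. If [x] is a plain power, they
    are [Omega]'s, so only the parts without [Omega] of [D^m], [E^m], [B] and [C]
    survive, and the [D^m] appear on the right of [C_+] instead of on its left.
    So the claim needs that [D^m_+] and [C_+] commute. This is where part (1) is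
    used, for [C], [A] and [B]: some [(z_i - w_i)^M] kills [[D^m(z), C(w)]], and on
    the part of this commutator that is a power series in [z] and [w] the factor
    [z_i - w_i] is not a zero divisor ([gcomm_kprod_Pow], [field_comm_nop]). *)

Set Implicit Arguments.
Unset Strict Implicit.
Unset Printing Implicit Defensive.
Import GRing.Theory.
Local Open Scope classical_set_scope.
Local Open Scope ring_scope.

(** * Multi-indices, division of monomials and sums of bounded support *)
Section MultiIndexTheory.
Variable n : nat.
Implicit Types (i : 'I_n) (j k l m : multi n) (x y q : mono n).

Lemma miD j k i : (j + k) i = (j i + k i)%N. Proof. by rewrite ffunE. Qed.
Lemma mi0 i : (0 : multi n) i = 0%N. Proof. by rewrite ffunE. Qed.
Lemma miB j k i : mi_sub j k i = (j i - k i)%N. Proof. by rewrite ffunE. Qed.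
Lemma mi1 i (l : 'I_n) : mi_unit i l = (l == i) :> nat. Proof. by rewrite ffunE. Qed.

Definition miE := (miD, mi0, miB, mi1).

Lemma mi_ext j k : (forall i, j i = k i) -> j = k.
Proof. by move=> h; apply/ffunP => i; exact: h. Qed.

Lemma mi_leP j k : reflect (forall i, (j i <= k i)%N) (mi_le j k).
Proof. exact: forallP. Qed.

Lemma mi_leNP j k : reflect (exists i, (k i < j i)%N) (~~ mi_le j k).
Proof.
rewrite negb_forall; apply: (iffP existsP) => -[i hi]; exists i; move: hi; lia.
Qed.

Lemma mi_le_refl j : mi_le j j. Proof. by apply/mi_leP. Qed.

Lemma mi_le_trans k j l : mi_le j k -> mi_le k l -> mi_le j l.
Proof. by move=> /mi_leP h /mi_leP h'; apply/mi_leP => i; exact: leq_trans (h' i). Qed.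

Definition mi_max j k : multi n := [ffun i => maxn (j i) (k i)].

Lemma mi_le_maxl j k : mi_le j (mi_max j k).
Proof. by apply/mi_leP => i; rewrite ffunE leq_maxl. Qed.

Lemma mi_le_maxr j k : mi_le k (mi_max j k).
Proof. by apply/mi_leP => i; rewrite ffunE leq_maxr. Qed.

Lemma finite_box k : finite_set [set j | mi_le j k].
Proof.
pose B := (\max_i k i)%N.
have : finite_set ((fun f : {ffun 'I_n -> 'I_B.+1} =>
    [ffun i => nat_of_ord (f i)] : multi n) @` setT).
  by apply/finite_image/finite_finset.
apply: sub_finite_set => j /= /mi_leP hj.
exists [ffun i => inord (j i)] => //; apply/ffunP => i; rewrite !ffunE inordK //.
by rewrite ltnS; apply: leq_trans (hj i) _; exact: leq_bigmax.
Qed.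

(** Division of monomials makes the sums in a product of series explicit: a
    factor and the product determine the other factor, because multiplication
    by [z^j] and by [Omega^j] is injective where it is not zero. *)
Definition mono_div y (mu : mono n) : option (mono n) :=
  match mu, y with
  | Pow j, Pow k => if mi_le j k then Some (Pow (mi_sub k j)) else None
  | Pow j, Om k => Some (Om (k + j))
  | Om j, Om k => if mi_le k j then Some (Pow (mi_sub j k)) else None
  | Om _, Pow _ => None
  end.

Lemma mi_subDl j k : mi_sub (j + k) j = k.
Proof. by apply/mi_ext => i; rewrite !miE; lia. Qed.

Lemma mi_subK j k : mi_le j k -> j + mi_sub k j = k.
Proof. by move/mi_leP => h; apply/mi_ext => i; rewrite !miE; have := h i; lia. Qed.

Lemma mi_le_addr j k : mi_le j (j + k).
Proof. by apply/mi_leP => i; rewrite !miE; lia. Qed.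

Lemma mi_le_sub j k : mi_le (mi_sub j k) j.
Proof. by apply/mi_leP => i; rewrite !miE; lia. Qed.

Lemma mono_divP mu q y : mono_mul mu q = Some y <-> mono_div y mu = Some q.
Proof.
case: mu => j; case: q => k; case: y => l //=; split=> //; try by case: ifP.
- by case=> <-; rewrite mi_le_addr mi_subDl.
- by case: ifP => // /mi_subK h [<-]; rewrite h.
- case: ifP => // h [<-]; congr (Some (Om _)).
  by rewrite addrC mi_subK.
- by case=> <-; rewrite addrC mi_le_addr mi_subDl.
- case: ifP => // h [<-]; rewrite mi_le_sub; congr (Some (Pow _)).
  by apply/mi_ext => i; move/mi_leP/(_ i): h; rewrite !miE; lia.
- case: ifP => // h [<-]; rewrite mi_le_sub; congr (Some (Om _)).
  by apply/mi_ext => i; move/mi_leP/(_ i): h; rewrite !miE; lia.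
Qed.

Lemma mono_div1 y : mono_div y (one_mono n) = Some y.
Proof. by apply/mono_divP; case: y => k /=; [|rewrite ifT]; rewrite ?add0r //;
  [congr (Some (Om _)); apply/mi_ext => i| apply/mi_leP => i]; rewrite !miE ?subn0. Qed.

Lemma mono_mulC x y : mono_mul x y = mono_mul y x.
Proof. by case: x => j; case: y => k //=; rewrite addrC. Qed.

Lemma mono_divD y (a b : multi n) :
  obind (mono_div^~ (Pow a)) (mono_div y (Pow b)) = mono_div y (Pow (b + a)).
Proof.
case: y => k /=; last by rewrite addrA.
case: ifP => /= [/mi_leP h|/negbT/mi_leNP[i hi]]; last first.
  by rewrite ifF //; apply/negbTE/mi_leNP; exists i; rewrite miE; lia.
have -> : mi_le a (mi_sub k b) = mi_le (b + a) k.
  by apply/mi_leP/mi_leP => h' i; move: (h i) (h' i); rewrite !miE; lia.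
by case: ifP => // _; congr (Some (Pow _)); apply/mi_ext => i; rewrite !miE; lia.
Qed.

(** Multiplications by two monomials, one of them without [Omega], commute also
    where they vanish. *)
Lemma mono_divC y l mu :
  obind (mono_div^~ mu) (mono_div y (Pow l)) =
  obind (mono_div^~ (Pow l)) (mono_div y mu).
Proof.
case: mu => j; first by rewrite !mono_divD addrC.
case: y => k /=.
- by case: ifP.
case: ifP => [/mi_leP h|/negbT/mi_leNP[i hi]]; last first.
  case: ifP => //= /mi_leP h; rewrite ifF //; apply/negbTE/mi_leNP; exists i.
  by move: hi (h i); rewrite !miE; lia.
have -> /= : mi_le k j by apply/mi_leP => i; move: (h i); rewrite !miE; lia.
rewrite ifT; last by apply/mi_leP => i; move: (h i); rewrite !miE; lia.
by congr (Some (Pow _)); apply/mi_ext => i; move: (h i); rewrite !miE; lia.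
Qed.

Lemma is_Om_div_Pow y l q : mono_div y (Pow l) = Some q -> is_Om q = is_Om y.
Proof. by case: y => k /=; [case: ifP => // _|] => -[<-]. Qed.

End MultiIndexTheory.

Section BoundedSums.
Variables (n : nat).
Implicit Types (K l : multi n).

Definition bounded (M : zmodType) (F : multi n -> M) :=
  exists K, forall l, ~~ mi_le l K -> F l = 0.

Definition msum (M : zmodType) (F : multi n -> M) : M := \sum_(l \in setT) F l.

Variable M : zmodType.
Implicit Types F G : multi n -> M.

(** A sum of bounded support can be taken over any large enough box, so that
    finitely many such sums can be compared over a common one. *)
Lemma msum_seq F : bounded F ->
  exists K, forall K', mi_le K K' ->
    msum F = \sum_(l <- finmap.enum_fset (fset_set [set l | mi_le l K'])) F l.
Proof.
move=> [K hK]; exists K => K' KK'; rewrite -fsbig_finite; last exact: finite_box.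
rewrite /msum; symmetry; apply: fsbig_widen => // l [_ /= /negP nl].
by apply: hK; apply: contra nl => /mi_le_trans; exact.
Qed.

Lemma eq_msum F G : F =1 G -> msum F = msum G.
Proof. by move/funext ->. Qed.

Lemma msum0 : msum (fun=> 0 : M) = 0.
Proof. exact: fsbig1. Qed.

Lemma bounded0 : bounded (fun=> 0 : M).
Proof. by exists 0. Qed.

Lemma boundedD F G : bounded F -> bounded G -> bounded (fun l => F l + G l).
Proof.
move=> [K hK] [L hL]; exists (mi_max K L) => l hl.
rewrite hK ?hL ?addr0 //; apply: contra hl => /mi_le_trans; apply.
  exact: mi_le_maxr.
exact: mi_le_maxl.
Qed.

Lemma msumD F G : bounded F -> bounded G ->
  msum (fun l => F l + G l) = msum F + msum G.
Proof.
move=> bF bG; have [K1 h1] := msum_seq bF; have [K2 h2] := msum_seq bG.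
have [K3 h3] := msum_seq (boundedD bF bG).
pose K := mi_max K1 (mi_max K2 K3).
have l3 : mi_le K3 K := mi_le_trans (mi_le_maxr _ _) (mi_le_maxr _ _).
have l2 : mi_le K2 K := mi_le_trans (mi_le_maxl _ _) (mi_le_maxr _ _).
by rewrite (h1 K (mi_le_maxl _ _)) (h2 _ l2) (h3 _ l3) big_split.
Qed.

Lemma bounded_sum (I : Type) (s : seq I) (F : I -> multi n -> M) :
  (forall i, bounded (F i)) -> bounded (fun l => \sum_(i <- s) F i l).
Proof.
move=> bF; elim: s => [|i s IH].
  by exists 0 => l _; rewrite big_nil.
have [K hK] := boundedD (bF i) IH.
by exists K => l /hK; rewrite big_cons.
Qed.

Lemma msum_sum (I : Type) (s : seq I) (F : I -> multi n -> M) :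
  (forall i, bounded (F i)) ->
  msum (fun l => \sum_(i <- s) F i l) = \sum_(i <- s) msum (F i).
Proof.
move=> bF; elim: s => [|i s IH].
  by rewrite big_nil -[RHS]msum0; apply: eq_msum => l; rewrite big_nil.
rewrite big_cons -IH -msumD //; last exact: bounded_sum.
by apply: eq_msum => l; rewrite big_cons.
Qed.

Lemma msum_shift (a : multi n) F :
  msum (fun l => if mi_le a l then F (mi_sub l a) else 0) = msum F.
Proof.
rewrite /msum [RHS](@reindex_fsbig _ _ _ _ _ (fun l => mi_sub l a) [set l | mi_le a l]).
  rewrite [RHS]fsbig_mkcond; apply: eq_fsbigr => l _.
  by rewrite /patch mem_setE.
split=> //= [l k|l _]; last first.
  exists (a + l); first exact: mi_le_addr.
  exact: mi_subDl.
rewrite !inE /= => /mi_subK hl /mi_subK hk e.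
by rewrite -hl -hk e.
Qed.

Lemma bounded_shift (a : multi n) F : bounded F ->
  bounded (fun l => if mi_le a l then F (mi_sub l a) else 0).
Proof.
move=> [K hK]; exists (K + a) => l /mi_leNP[i hi]; case: ifP => // /mi_leP h.
by apply: hK; apply/mi_leNP; exists i; move: hi (h i); rewrite !miE; lia.
Qed.

Lemma msum_flip (p : multi n) F :
  msum (fun l => if mi_le l p then F (mi_sub p l) else 0) =
  msum (fun l => if mi_le l p then F l else 0).
Proof.
have E (H : multi n -> M) : msum (fun l => if mi_le l p then H l else 0) =
    \sum_(l \in [set l | mi_le l p]) H l.
  rewrite [RHS]fsbig_mkcond; apply: eq_fsbigr => l _.
  by rewrite /patch mem_setE.
rewrite !E [RHS](@reindex_fsbig _ _ _ _ _ (fun l => mi_sub p l) [set l | mi_le l p]) //.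
have inv l : mi_le l p -> mi_sub p (mi_sub p l) = l.
  by move/mi_leP => h; apply/mi_ext => i; move: (h i); rewrite !miE; lia.
split=> /= [l _|l k|l hl]; first exact: mi_le_sub.
  by rewrite !inE /= => /inv hl /inv hk e; rewrite -hl -hk e.
by exists (mi_sub p l); [exact: mi_le_sub | exact: inv].
Qed.

End BoundedSums.

Lemma bounded_lin (n : nat) (M L : zmodType) (f : M -> L) (F : multi n -> M) :
  f 0 = 0 -> bounded F -> bounded (fun l => f (F l)).
Proof. by move=> f0 [K hK]; exists K => l /hK ->. Qed.

Lemma msum_lin (n : nat) (M L : zmodType) (f : {additive M -> L}) (F : multi n -> M) :
  bounded F -> f (msum F) = msum (fun l => f (F l)).
Proof.
move=> bF; have [K1 h1] := msum_seq bF.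
have [K2 h2] := msum_seq (bounded_lin (raddf0 f) bF).
rewrite (h1 _ (mi_le_maxl K1 K2)) (h2 _ (mi_le_maxr K1 K2)).
by rewrite raddf_sum.
Qed.
Arguments mono_div {n} y mu : simpl never.

(** * Signs, graded commutators and products of series *)
Section Signs.
Variable R : comPzRingType.
Implicit Types a b : int.

Definition par a := odd `|a|%N.

Lemma parD a b : par (a + b) = par a (+) par b.
Proof. rewrite /par; lia. Qed.

Lemma parN a : par (- a) = par a.
Proof. by rewrite /par abszN. Qed.

Lemma parM a b : par (a * b) = par a && par b.
Proof. by rewrite /par abszM oddM. Qed.

Lemma par_nOm n (x : mono n) : par (nOm x) = is_Om x.
Proof. by rewrite /nOm /par; case: is_Om. Qed.

Lemma par_bool (b : bool) : par (b : nat)%:Z = b.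
Proof. by case: b. Qed.

Lemma par1 : par 1%:Z = true. Proof. by []. Qed.

Definition parE := (parD, parN, parM, par_nOm, par_bool, par1).

Lemma eq_zsign a b : par a = par b -> zsign R a = zsign R b.
Proof. by rewrite /zsign /par -signr_odd => ->; rewrite signr_odd. Qed.

Lemma zsignM a b : zsign R a * zsign R b = zsign R (a + b).
Proof.
by rewrite /zsign -(signr_odd R `|a|) -(signr_odd R `|b|) -(signr_odd R `|a + b|)
  -!/(par _) parD signr_addb.
Qed.

Lemma zsign0 a : par a = false -> zsign R a = 1.
Proof. by rewrite /zsign /par -signr_odd => ->. Qed.

Lemma zsign_sqr a : zsign R a * zsign R a = 1.
Proof. by rewrite zsignM zsign0 // parD addbb. Qed.

Lemma zsign_scalerK (E : lmodType R) a : injective (fun u : E => zsign R a *: u).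
Proof.
by move=> u v /(congr1 ( *:%R (zsign R a))); rewrite !scalerA zsign_sqr !scale1r.
Qed.

End Signs.

(** Products of signs are equal as soon as the exponents have equal parities,
    and the latter follow from the parities of the degrees by cases. *)
Ltac zsign_tac :=
  rewrite ?zsignM; apply: eq_zsign; rewrite ?parE /=;
  repeat match goal with |- context [par ?a] => case: (par a) end;
  try done.

Section EndTheory.
Variables (R : comPzRingType) (V : lmodType R).
Implicit Types (f g h : End V) (a b c : int).

Lemma end_compDl f g h : end_comp (f + g) h = end_comp f h + end_comp g h.
Proof. exact: endP. Qed.
Lemma end_compDr f g h : end_comp h (f + g) = end_comp h f + end_comp h g.
Proof. by apply: endP => v /=; rewrite linearD. Qed.
Lemma end_compNl f h : end_comp (- f) h = - end_comp f h.
Proof. exact: endP. Qed.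
Lemma end_compNr f h : end_comp h (- f) = - end_comp h f.
Proof. by apply: endP => v /=; rewrite linearN. Qed.
Lemma end_compZl (t : R) f h : end_comp (t *: f) h = t *: end_comp f h.
Proof. exact: endP. Qed.
Lemma end_compZr (t : R) f h : end_comp h (t *: f) = t *: end_comp h f.
Proof. by apply: endP => v /=; rewrite linearZ. Qed.
Lemma end_scaleCA (t t' : R) f : t *: (t' *: f) = t' *: (t *: f).
Proof. by rewrite !scalerA mulrC. Qed.
Lemma end_compA f g h : end_comp f (end_comp g h) = end_comp (end_comp f g) h.
Proof. exact: endP. Qed.
Lemma end_comp0l f : end_comp 0 f = 0.
Proof. exact: endP. Qed.
Lemma end_comp0r f : end_comp f 0 = 0.
Proof. by apply: endP => v /=; rewrite linear0. Qed.

(** The degrees are explicit arguments: they enter through the signs only, and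
    the identities below are formal in them. *)
Definition gcomm a b f g : End V :=
  end_comp f g - zsign R (a * b) *: end_comp g f.

Lemma gcommE a b f g v : gcomm a b f g v = f (g v) - zsign R (a * b) *: g (f v).
Proof. by []. Qed.

Lemma gcomm0l a b g : gcomm a b 0 g = 0.
Proof. by rewrite /gcomm end_comp0l end_comp0r scaler0 subr0. Qed.

Lemma gcomm0r a b f : gcomm a b f 0 = 0.
Proof. by rewrite /gcomm end_comp0l end_comp0r scaler0 subr0. Qed.

Lemma gcommDr a b f g h : gcomm a b f (g + h) = gcomm a b f g + gcomm a b f h.
Proof. by rewrite /gcomm end_compDl end_compDr scalerDr opprD addrACA. Qed.

Lemma gcommBl a b f g h : gcomm a b (f - g) h = gcomm a b f h - gcomm a b g h.
Proof.
rewrite /gcomm end_compDl end_compDr end_compNl end_compNr scalerBr.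
by rewrite !opprB addrACA [RHS]addrACA; congr (_ + _); rewrite addrC.
Qed.

Lemma gcommBr a b f g h : gcomm a b f (g - h) = gcomm a b f g - gcomm a b f h.
Proof.
rewrite /gcomm end_compDl end_compDr end_compNl end_compNr scalerBr.
by rewrite !opprB addrACA [RHS]addrACA; congr (_ + _); rewrite addrC.
Qed.

Lemma gcommZr a b f t g : gcomm a b f (t *: g) = t *: gcomm a b f g.
Proof.
by rewrite /gcomm end_compZl end_compZr scalerBr !scalerA [t * _]mulrC.
Qed.

Lemma gcomm_skew a b f g : gcomm b a g f = - (zsign R (a * b) *: gcomm a b f g).
Proof.
by rewrite /gcomm scalerBr scalerA zsign_sqr scale1r opprB [b * a]mulrC.
Qed.

Lemma gcomm_comp a b c f g h :
  gcomm a (b + c) f (end_comp g h) =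
  end_comp (gcomm a b f g) h + zsign R (a * b) *: end_comp g (gcomm a c f h).
Proof.
rewrite /gcomm end_compDl end_compDr end_compNl end_compNr end_compZl end_compZr.
rewrite scalerBr scalerA zsignM -mulrDr !end_compA.
by rewrite addrA subrK.
Qed.

Lemma gcomm_jacobi a b c f g h :
  gcomm a (b + c) f (gcomm b c g h) =
  gcomm (a + b) c (gcomm a b f g) h
  + zsign R (a * b) *: gcomm b (a + c) g (gcomm a c f h).
Proof.
rewrite [gcomm b c g h]/gcomm gcommBr gcommZr gcomm_comp.
rewrite [b + c]addrC gcomm_comp.
rewrite [gcomm (a + b) c _ h]/gcomm [gcomm b (a + c) g _]/gcomm.
rewrite !scalerDr !scalerN !scalerA !zsignM.
have -> : zsign R (b * c + a * c) = zsign R ((a + b) * c) by zsign_tac.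
have -> : zsign R (a * b + b * (a + c)) = zsign R (b * c) by zsign_tac.
by rewrite [X in _ - X]addrC opprD addrACA.
Qed.

End EndTheory.

(** By division of monomials the right monomial is determined by the left one,
    so a product of series is a finite sum over left monomials whenever only
    finitely many of these contribute. *)
Lemma series_mulE (R : comPzRingType) (n : nat) (N : int) (E1 E2 : Type)
    (E3 : lmodType R) (op : E1 -> E2 -> E3) p (F : K2 n E1) (G : K2 n E2) x y
    (s : seq (mono n * mono n)) :
  uniq s ->
  (forall a b, a \notin s -> mono_mul a.1 b.1 = Some x ->
     mono_mul a.2 b.2 = Some y -> op (F a.1 a.2) (G b.1 b.2) = 0) ->
  series_mul N op p F G x y =
  \sum_(a <- s)
    if mono_div x a.1 is Some u then
      if mono_div y a.2 is Some w then
        zsign R ((p - N * (nOm a.1 + nOm a.2)) * N * (nOm u + nOm w)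
                 + N * nOm a.2 * nOm u) *: op (F a.1 a.2) (G u w)
      else 0
    else 0.
Proof.
move=> us out; rewrite /series_mul.
pose h (a : mono n * mono n) := (a, (odflt a.1 (mono_div x a.1), odflt a.2 (mono_div y a.2))).
pose ok (a : mono n * mono n) := mono_div x a.1 && mono_div y a.2.
transitivity (\sum_(q <- [seq h a | a <- s & ok a])
    zsign R ((p - N * (nOm q.1.1 + nOm q.1.2)) * N * (nOm q.2.1 + nOm q.2.2)
             + N * nOm q.1.2 * nOm q.2.1)
    *: op (F q.1.1 q.1.2) (G q.2.1 q.2.2)); last first.
  rewrite big_map big_filter big_mkcond /=; apply: eq_bigr => a _; rewrite /ok /h.
  by case: (mono_div x a.1) => [u|]; case: (mono_div y a.2) => [w|].
rewrite [RHS]fsbig_seq; last by rewrite map_inj_uniq ?filter_uniq // => a b [].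
symmetry; apply: fsbig_widen.
  move=> q /= /mapP[a + ->]; rewrite mem_filter /ok /h => /andP[+ _] /=.
  case ex: (mono_div x a.1) => [u|] //; case ey: (mono_div y a.2) => [w|] //= _.
  by split; apply/mono_divP.
move=> [a b] /= [[hx hy]] /negP nin; rewrite out ?scaler0 //.
apply/negP => sa; move/negP: nin; apply; apply/mapP; exists a.
  by rewrite mem_filter sa /ok ((mono_divP _ _ _).1 hx) ((mono_divP _ _ _).1 hy).
by rewrite /h ((mono_divP _ _ _).1 hx) ((mono_divP _ _ _).1 hy) /=; case: (b).
Qed.

Section Products.
Variables (R : comPzRingType) (n : nat) (N : int).
Implicit Types (x y : mono n).

Lemma mono_mul1 x y : mono_mul x (one_mono n) = Some y -> x = y.
Proof. by rewrite mono_mulC => /mono_divP; rewrite mono_div1 => -[]. Qed.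

Lemma nOm1 : nOm (one_mono n) = 0. Proof. by []. Qed.

Lemma mono_divv x : mono_div x x = Some (one_mono n).
Proof. by apply/mono_divP; rewrite mono_mulC; apply/mono_divP; rewrite mono_div1. Qed.

Variable V : lmodType R.
Implicit Types (A B C : K1 n (End V)) (p q : int).

Lemma prod_zwE p A B x y :
  prod_zw N p A B x y =
  zsign R ((p - N * nOm x) * N * nOm y) *: end_comp (A x) (B y).
Proof.
rewrite /prod_zw (@series_mulE _ _ _ _ _ _ _ _ _ _ _ _ [:: (x, one_mono n)]) //.
  rewrite big_seq1 /= !mono_divv !mono_div1 /in_z /in_w !eqxx !nOm1.
  by rewrite !addr0 !add0r mulr0 addr0.
move=> [a a'] [b b'] /=; rewrite /in_z /in_w inE xpair_eqE negb_and.
case: (a' =P _) => [->|_]; last by rewrite end_comp0l.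
case: (b =P _) => [->|_]; last by rewrite end_comp0r.
by move=> + /mono_mul1 e; rewrite e !eqxx.
Qed.

Lemma prod_wzE p A B x y :
  prod_wz N p B A x y =
  zsign R ((p - N * nOm y) * N * nOm x + N * nOm y * nOm x)
    *: end_comp (B y) (A x).
Proof.
rewrite /prod_wz (@series_mulE _ _ _ _ _ _ _ _ _ _ _ _ [:: (one_mono n, y)]) //.
  rewrite big_seq1 /= !mono_divv !mono_div1 /in_z /in_w !eqxx !nOm1.
  by rewrite !addr0 !add0r.
move=> [a a'] [b b'] /=; rewrite /in_z /in_w inE xpair_eqE negb_and.
case: (a =P _) => [->|_]; last by rewrite end_comp0l.
case: (b' =P _) => [->|_]; last by rewrite end_comp0r.
by move=> + _ /mono_mul1 e; rewrite e !eqxx.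
Qed.

(** Bringing the symbols to the left of the coefficients costs a sign in each of
    the two products. The quotient of the two signs turns [p(A,B)] into the sign
    of the exchange of the two coefficients, whose degrees are lowered by [N] at
    each [Omega]. *)
Lemma field_commE p q A B x y :
  field_comm N p q A B x y =
  zsign R ((p - N * nOm x) * N * nOm y)
    *: gcomm (p - N * nOm x) (q - N * nOm y) (A x) (B y).
Proof.
rewrite -[LHS]/(prod_zw N p A B x y - zsign R (p * q) *: prod_wz N q B A x y).
rewrite prod_zwE prod_wzE /gcomm scalerBr !scalerA !zsignM.
congr (_ - _ *: _).
by zsign_tac; case: is_Om; case: is_Om.
Qed.

End Products.

(** * Multiplication by a difference of two variables *)
Section Multiplication.
Variables (R : comPzRingType) (n : nat) (N : int) (E : lmodType R).
Implicit Types (x y : mono n) (f g : K2 n E) (i : 'I_n) (j k m : multi n).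

Definition mono_var i : mono n := Pow (mi_unit i).

(** Multiplication by the variable [z_i], on coefficients. *)
Definition shift i (g : mono n -> E) y : E := oapp g 0 (mono_div y (mono_var i)).

(** Multiplication by [z_i - w_i], on coefficients. *)
Definition zw_mul i f : K2 n E := fun x y => shift i (f^~ y) x - shift i (f x) y.

Lemma mono_var_neq1 i : mono_var i != one_mono n.
Proof. by apply/eqP => -[] /(congr1 (fun j : multi n => j i)); rewrite !miE eqxx. Qed.

Lemma zw_mulE i f : series_mul N *:%R 0 (var_z R i - var_w R i) f = zw_mul i f.
Proof.
apply/funext => x; apply/funext => y.
have vE a b : (var_z R i - var_w R i) a b =
   (if b == one_mono n then (a == mono_var i)%:R else 0) -
   (if a == one_mono n then (b == mono_var i)%:R else 0) by [].
have n1 := mono_var_neq1 i; have n1' : one_mono n != mono_var i by rewrite eq_sym.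
rewrite (@series_mulE _ _ _ _ _ _ _ _ _ _ _ _
  [:: (mono_var i, one_mono n); (one_mono n, mono_var i)]).
- rewrite !big_cons big_nil !mono_div1 addr0 !vE !eqxx (negbTE n1) /= addr0 /zw_mul /shift.
  congr (_ + _); case: mono_div => [q|] /=; rewrite ?oppr0 //.
    by rewrite zsign0 ?parE /= ?andbF // addr0 !scale1r.
  by rewrite zsign0 ?parE /= ?andbF // sub0r scale1r scaleN1r.
- by rewrite /= inE xpair_eqE (negbTE n1).
move=> [a b] [a' b'] + _ _; rewrite !inE !xpair_eqE vE /=.
have [->|_] := eqVneq a (one_mono n); have [->|_] := eqVneq b (one_mono n);
  rewrite ?eqxx ?[one_mono n == mono_var i]eq_sym ?(negbTE n1) ?andbF ?andbT ?orbF //=.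
- by rewrite subr0 scale0r.
- by move/negbTE => ->; rewrite subr0 scale0r.
- by move/negbTE => ->; rewrite subr0 scale0r.
- by rewrite subr0 scale0r.
Qed.

Lemma zw_powE i r f : zw_pow N i r f = iter r (zw_mul i) f.
Proof. by rewrite /zw_pow; apply: eq_iter => g; exact: zw_mulE. Qed.

Lemma shiftD i (g h : mono n -> E) y :
  shift i (fun q => g q + h q) y = shift i g y + shift i h y.
Proof. by rewrite /shift; case: mono_div => //=; rewrite addr0. Qed.

Lemma shiftB i (g h : mono n -> E) y :
  shift i (fun q => g q - h q) y = shift i g y - shift i h y.
Proof. by rewrite /shift; case: mono_div => //=; rewrite subr0. Qed.

Lemma shift0 i y : shift i (fun=> 0) y = 0.
Proof. by rewrite /shift; case: mono_div. Qed.

Lemma shiftC i i' (g : mono n -> E) y :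
  shift i (shift i' g) y = shift i' (shift i g) y.
Proof.
rewrite /shift; have := mono_divC y (mi_unit i) (mono_var i'); rewrite -/(mono_var i).
case: (mono_div y (mono_var i)) => [q|]; case: (mono_div y (mono_var i')) => [q'|] //=.
- by move=> ->.
- by move=> ->.
- by move=> <-.
Qed.

Lemma shift_swap i i' (F : mono n -> mono n -> E) x y :
  shift i (fun a => shift i' (F a) y) x = shift i' (fun b => shift i (F^~ b) x) y.
Proof. by rewrite /shift; case: mono_div; case: mono_div. Qed.

Lemma zw_mulD i f g : zw_mul i (f + g) = zw_mul i f + zw_mul i g.
Proof.
apply/funext => x; apply/funext => y; rewrite /zw_mul.
rewrite -[RHS]/(shift i (f^~ y) x - shift i (f x) y + (shift i (g^~ y) x - shift i (g x) y)).
by rewrite [in LHS]shiftD (shiftD i (f x)) opprD addrACA.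
Qed.

Lemma zw_mul0 i : zw_mul i 0 = 0.
Proof. by apply/funext => x; apply/funext => y; rewrite /zw_mul !shift0 subr0. Qed.

Lemma iter_zw_mulD i r f g :
  iter r (zw_mul i) (f + g) = iter r (zw_mul i) f + iter r (zw_mul i) g.
Proof. by elim: r => //= r ->; rewrite zw_mulD. Qed.

Lemma iter_zw_mul0 i r : iter r (zw_mul i) 0 = 0.
Proof. by elim: r => //= r ->; rewrite zw_mul0. Qed.

Lemma zw_mpowD k f g : zw_mpow N k (f + g) = zw_mpow N k f + zw_mpow N k g.
Proof.
rewrite /zw_mpow; elim: (enum 'I_n) => //= i s ->.
by rewrite !zw_powE iter_zw_mulD.
Qed.

Lemma zw_mpow0 k : zw_mpow N k (0 : K2 n E) = 0.
Proof.
rewrite /zw_mpow; elim: (enum 'I_n) => //= i s ->.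
by rewrite !zw_powE iter_zw_mul0.
Qed.

(** Multiplication by the variables keeps the kinds of the symbols, so it
    commutes with additive maps on coefficients that depend on these kinds
    only, such as signs and commutators with a fixed coefficient. *)
Lemma iter_zw_mul_map (L : bool -> bool -> E -> E) i r f :
  (forall b c u v, L b c (u - v) = L b c u - L b c v) ->
  iter r (zw_mul i) (fun x y => L (is_Om x) (is_Om y) (f x y)) =
  fun x y => L (is_Om x) (is_Om y) (iter r (zw_mul i) f x y).
Proof.
move=> LB; have L0 b c : L b c 0 = 0 by rewrite -(subrr 0) LB !subrr.
elim: r => //= r ->; apply/funext => x; apply/funext => y.
rewrite /zw_mul LB /shift; congr (_ - _).
  by case e: mono_div => [q|] /=; rewrite ?L0 // (is_Om_div_Pow e).
by case e: mono_div => [q|] /=; rewrite ?L0 // (is_Om_div_Pow e).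
Qed.

Lemma zw_mpow_map (L : bool -> bool -> E -> E) k f :
  (forall b c u v, L b c (u - v) = L b c u - L b c v) ->
  zw_mpow N k (fun x y => L (is_Om x) (is_Om y) (f x y)) =
  fun x y => L (is_Om x) (is_Om y) (zw_mpow N k f x y).
Proof.
move=> LB; rewrite /zw_mpow; elim: (enum 'I_n) => //= i l ->.
by rewrite !zw_powE (iter_zw_mul_map _ _ _ LB).
Qed.

Lemma iter_zw_mul_swap i r f x y :
  iter r (zw_mul i) (fun x y => f y x) x y = (-1) ^+ r *: iter r (zw_mul i) f y x.
Proof.
elim: r x y => [|r IH] x y /=; first by rewrite expr0 scale1r.
rewrite exprS mulN1r scaleNr /zw_mul /shift -scalerN opprB scalerBr.
congr (_ - _); case: mono_div => [q|] /=; rewrite ?scaler0 //; exact: IH.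
Qed.

(** On power series [z_i - w_i] is not a zero divisor: comparing coefficients
    expresses one with exponent [k_i] of [w_i] by one with exponent
    [k_i - 1]. *)
Lemma zw_mul_PowPow i f : (forall j k, zw_mul i f (Pow j) (Pow k) = 0) ->
  forall j k, f (Pow j) (Pow k) = 0.
Proof.
move=> h j k; elim: {k}(k i) {-2}k (erefl (k i)) j => [|c IH] k kc j.
  have := h (j + mi_unit i) k; rewrite /zw_mul /shift /mono_div /=.
  rewrite ifT; last by apply/mi_leP => l; rewrite !miE; lia.
  rewrite ifF /=; last first.
    by apply/negbTE/mi_leNP; exists i; rewrite !miE eqxx kc.
  by rewrite subr0 addrC mi_subDl.
have := h (j + mi_unit i) k; rewrite /zw_mul /shift /mono_div /=.
rewrite ifT; last by apply/mi_leP => l; rewrite !miE; lia.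
case: ifP => [_|_] /=; last by rewrite subr0 addrC mi_subDl.
rewrite [X in _ - X]IH; first by rewrite subr0 addrC mi_subDl.
by rewrite !miE eqxx kc; lia.
Qed.

Lemma iter_zw_mul_PowPow i r f :
  iter r (zw_mul i) f = 0 -> forall j k, f (Pow j) (Pow k) = 0.
Proof.
move=> h; have : forall j k, iter r (zw_mul i) f (Pow j) (Pow k) = 0 by move=> j k; rewrite h.
by elim: r {h} => //= r IH /zw_mul_PowPow.
Qed.

End Multiplication.

(** * Dong's lemma in three groups of variables *)
Section CommutingOperators.
Variables (U : zmodType) (P Q : U -> U).
Hypothesis PD : forall f g, P (f + g) = P f + P g.
Hypothesis QD : forall f g, Q (f + g) = Q f + Q g.
Hypothesis PQ : forall f, P (Q f) = Q (P f).

Let T f := P f + Q f.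

Lemma iter_comm (A B : U -> U) r f : (forall f, A (B f) = B (A f)) ->
  iter r A (B f) = B (iter r A f).
Proof. by move=> AB; elim: r => //= r ->. Qed.

Lemma iter_add (A : U -> U) r f g : (forall f g, A (f + g) = A f + A g) ->
  iter r A (f + g) = iter r A f + iter r A g.
Proof. by move=> AD; elim: r => //= r ->. Qed.

Lemma iter_zero (A : U -> U) r : (forall f g, A (f + g) = A f + A g) -> iter r A 0 = 0.
Proof.
move=> AD; have /(congr1 (+%R^~ (- iter r A 0))) := iter_add r 0 0 AD.
by rewrite addr0 subrr addrK.
Qed.

(** Every term of the binomial expansion of [(P + Q) ^ (a + b)] contains
    [P ^ a] or [Q ^ b]; the induction avoids the binomial coefficients. *)
Lemma iter_sum_closed (S : U -> Prop) a b f :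
  (forall f g, S f -> S g -> S (f + g)) ->
  (forall f, S f -> S (P f)) -> (forall f, S f -> S (Q f)) ->
  S (iter a P f) -> S (iter b Q f) -> S (iter (a + b) T f).
Proof.
move=> SD SP SQ.
have TD g h : T (g + h) = T g + T h by rewrite /T PD QD addrACA.
have ST c g : S g -> S (iter c T g).
  by move=> Sg; elim: c => //= c IH; apply: SD; [apply: SP|apply: SQ].
elim: a b f => [|a IHa] b f Sa Sb; first exact: ST.
elim: b f Sa Sb => [|b IHb] f Sa Sb; first exact: ST.
rewrite addSn iterSr iter_add //; apply: SD.
  apply: IHa; first by rewrite -iterSr.
  by rewrite iter_comm //; apply: SP.
rewrite addnS -addSn; apply: IHb; last by rewrite -iterSr.
by rewrite iter_comm //; apply: SQ.
Qed.

(** The algebra behind Dong's lemma. After [2r] factors [P + Q] the terms with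
    [Q ^ r] are gone because [Q ^ r] kills [F], and those with [P ^ r] only see
    [H] because [P ^ r] kills [G]; the remaining [r] factors kill [H]. *)
Lemma iter_dong r F G H : F = G + H ->
  iter r P G = 0 -> iter r Q F = 0 -> iter r T H = 0 -> iter (3 * r) T F = 0.
Proof.
move=> FGH G0 F0 H0.
have TD g h : T (g + h) = T g + T h by rewrite /T PD QD addrACA.
have PT f : P (T f) = T (P f) by rewrite /T PD PQ.
have QT f : Q (T f) = T (Q f) by rewrite /T QD PQ.
have -> : (3 * r = r + (r + r))%N by lia.
rewrite iterD; apply: (@iter_sum_closed (fun f => iter r T f = 0)).
- by move=> f g f0 g0; rewrite iter_add // f0 g0 addr0.
- by move=> f f0; rewrite iter_comm // f0; exact: iter_zero 1%N PD.
- by move=> f f0; rewrite iter_comm // f0; exact: iter_zero 1%N QD.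
- rewrite FGH iter_add // G0 add0r (@iter_comm T (iter r P)) ?H0 ?iter_zero //.
  by move=> f; rewrite iter_comm.
- by rewrite F0 iter_zero.
Qed.

End CommutingOperators.

Section Dong.
Variables (R : comPzRingType) (n : nat) (N : int) (V : lmodType R).
Implicit Types (x u y : mono n) (i : 'I_n) (A B C : K1 n (End V)).
Implicit Types (F : mono n -> K2 n (End V)).

(** Multiplication by [z_i - x_i], [x_i - w_i] and [z_i - w_i] on series in
    [z], [x] and [w]; the arguments [x], [u], [y] are the monomials in these
    three groups of variables. *)
Definition zx_mul i F : mono n -> K2 n (End V) :=
  fun x u y => zw_mul i (fun a b => F a b y) x u.
Definition xw_mul i F : mono n -> K2 n (End V) :=
  fun x u y => zw_mul i (F x) u y.
Definition zw_mul3 i F : mono n -> K2 n (End V) :=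
  fun x u y => zw_mul i (fun a c => F a u c) x y.

Ltac k3ext := apply/funext => x; apply/funext => u; apply/funext => y.

Lemma zw_mul3E i F : zw_mul3 i F = zx_mul i F + xw_mul i F.
Proof.
k3ext; rewrite -[RHS]/(zx_mul i F x u y + xw_mul i F x u y).
by rewrite /zx_mul /xw_mul /zw_mul3 /zw_mul subrKA.
Qed.

Lemma zx_mulD i F G : zx_mul i (F + G) = zx_mul i F + zx_mul i G.
Proof.
k3ext; rewrite -[RHS]/(zx_mul i F x u y + zx_mul i G x u y) /zx_mul.
by rewrite (@zw_mulD _ _ _ i (fun a b => F a b y) (fun a b => G a b y)).
Qed.

Lemma xw_mulD i F G : xw_mul i (F + G) = xw_mul i F + xw_mul i G.
Proof.
k3ext; rewrite -[RHS]/(xw_mul i F x u y + xw_mul i G x u y) /xw_mul.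
by rewrite (@zw_mulD _ _ _ i (F x) (G x)).
Qed.

Lemma zx_xwC i j F : zx_mul i (xw_mul j F) = xw_mul j (zx_mul i F).
Proof.
k3ext; rewrite /zx_mul /xw_mul /zw_mul !shiftB.
rewrite (@shift_swap _ _ _ i j (fun a b => F a b y)).
rewrite (@shift_swap _ _ _ i j (fun a c => F a u c)).
rewrite (@shift_swap _ _ _ i j (F x)) (shiftC i j).
by rewrite [in LHS]opprD addrACA -opprD.
Qed.

Lemma xw_xwC i j F : xw_mul i (xw_mul j F) = xw_mul j (xw_mul i F).
Proof.
k3ext; rewrite /xw_mul /zw_mul !shiftB.
rewrite (@shift_swap _ _ _ i j (F x)) -(@shift_swap _ _ _ j i (F x)).
by rewrite (shiftC i j) [X in _ - (_ - X)]shiftC [in LHS]opprD addrACA -opprD.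
Qed.

Lemma zw_xwC i j F : zw_mul3 i (xw_mul j F) = xw_mul j (zw_mul3 i F).
Proof. by rewrite !zw_mul3E xw_mulD zx_xwC xw_xwC. Qed.

Lemma iter_zx i r F x u y :
  iter r (zx_mul i) F x u y = iter r (zw_mul i) (fun a b => F a b y) x u.
Proof.
elim: r x u => //= r IH x u; rewrite /zx_mul; congr (zw_mul i _ x u).
by apply/funext => a; apply/funext => b; exact: IH.
Qed.

Lemma iter_xw i r F x : iter r (xw_mul i) F x = iter r (zw_mul i) (F x).
Proof. by elim: r => //= r IH; rewrite /xw_mul IH. Qed.

Lemma iter_zw3 i r F x u y :
  iter r (zw_mul3 i) F x u y = iter r (zw_mul i) (fun a c => F a u c) x y.
Proof.
elim: r x y => //= r IH x y; rewrite /zw_mul3; congr (zw_mul i _ x y).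
by apply/funext => a; apply/funext => b; exact: IH.
Qed.

Lemma zw_mpow_xw (k : multi n) F x :
  zw_mpow N k (F x) = foldr (fun j g => iter (k j) (xw_mul j) g) F (enum 'I_n) x.
Proof.
rewrite /zw_mpow; elim: (enum 'I_n) => //= i s ->.
by rewrite zw_powE iter_xw.
Qed.

(** The commutator of two series without the signs that come from the symbols,
    in a form to which the Jacobi identity applies directly. *)
Definition ccomm (p q : int) A B : K2 n (End V) :=
  fun x y => gcomm (p - N * nOm x) (q - N * nOm y) (A x) (B y).

Definition sym_sign (p : int) (b c : bool) : R :=
  zsign R ((p - N * (b : nat)%:Z) * N * (c : nat)%:Z).

Lemma field_comm_ccomm p q A B :
  field_comm N p q A B =
  fun x y => sym_sign p (is_Om x) (is_Om y) *: ccomm p q A B x y.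
Proof. by apply/funext => x; apply/funext => y; rewrite field_commE. Qed.

(** The signs that come from the symbols are invertible and depend on the kinds
    of the symbols only, so they do not affect the vanishing. *)
Lemma zw_pow_commE p q A B i r :
  zw_pow N i r (field_comm N p q A B) = 0 <->
  iter r (zw_mul i) (ccomm p q A B) = 0.
Proof.
rewrite zw_powE field_comm_ccomm.
rewrite (@iter_zw_mul_map _ _ _ (fun b c f => sym_sign p b c *: f)); last first.
  by move=> b c f g; rewrite scalerBr.
split=> [h|->]; apply/funext => x; apply/funext => y; last exact: scaler0.
have /(congr1 (fun f => f x y)) e := h.
by apply: (@zsign_scalerK R); rewrite scaler0; exact: e.
Qed.

Lemma zw_pow_comm_swap p q A B i r :
  zw_pow N i r (field_comm N p q A B) = 0 ->
  zw_pow N i r (field_comm N q p B A) = 0.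
Proof.
move/zw_pow_commE => h; apply/zw_pow_commE.
have -> : ccomm q p B A = fun y x =>
    - (zsign R ((p - N * nOm x) * (q - N * nOm y)) *: ccomm p q A B x y).
  by apply/funext => y; apply/funext => x; rewrite /ccomm gcomm_skew.
rewrite (@iter_zw_mul_map _ _ _ (fun b c f => - (zsign R
  ((p - N * (c : nat)%:Z) * (q - N * (b : nat)%:Z)) *: f)) _ _ (fun y x => ccomm p q A B x y)).
  by apply/funext => y; apply/funext => x; rewrite iter_zw_mul_swap h !scaler0 oppr0.
by move=> b c f g; rewrite scalerBr opprB opprK addrC.
Qed.

(** The series [[A(z), [B(x), C(w)]]] is [F] in the algebraic lemma, and the
    Jacobi identity splits it into [[[A(z), B(x)], C(w)]], killed by a power of
    [z_i - x_i], and a multiple of [[B(x), [A(z), C(w)]]], killed by a power of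
    [z_i - w_i]. Multiplying by [(x - w)^k] and taking the residue in [x]
    commutes with [z_i - w_i]. *)
Lemma dong_commutator pA pB pC A B C i k r :
  zw_pow N i r (field_comm N pA pB A B) = 0 ->
  zw_pow N i r (field_comm N pA pC A C) = 0 ->
  zw_pow N i r (field_comm N pB pC B C) = 0 ->
  zw_pow N i (3 * r)
    (field_comm N pA (pB + pC - N) A (kprod N pB pC k B C)) = 0.
Proof.
move=> /zw_pow_commE hAB /zw_pow_commE hAC /zw_pow_commE hBC; apply/zw_pow_commE.
pose d p (b : bool) := p - N * (b : nat)%:Z.
pose F x u y := gcomm (d pA (is_Om x)) (d pB (is_Om u) + d pC (is_Om y))
  (A x) (ccomm pB pC B C u y).
pose G x u y := gcomm (d pA (is_Om x) + d pB (is_Om u)) (d pC (is_Om y))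
  (ccomm pA pB A B x u) (C y).
pose H x u y := zsign R (d pA (is_Om x) * d pB (is_Om u)) *:
  gcomm (d pB (is_Om u)) (d pA (is_Om x) + d pC (is_Om y)) (B u) (ccomm pA pC A C x y).
have FGH : F = G + H by k3ext; exact: gcomm_jacobi.
have G0 : iter r (zx_mul i) G = 0.
  k3ext; rewrite iter_zx.
  rewrite (@iter_zw_mul_map _ _ _
    (fun b c f => gcomm (d pA b + d pB c) (d pC (is_Om y)) f (C y))).
    by rewrite hAB gcomm0l.
  by move=> *; exact: gcommBl.
have F0 : iter r (xw_mul i) F = 0.
  apply/funext => x; rewrite iter_xw.
  rewrite (@iter_zw_mul_map _ _ _
    (fun b c f => gcomm (d pA (is_Om x)) (d pB b + d pC c) (A x) f)).
    by rewrite hBC; apply/funext => u; apply/funext => y; rewrite gcomm0r.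
  by move=> *; exact: gcommBr.
have H0 : iter r (zw_mul3 i) H = 0.
  k3ext; rewrite iter_zw3.
  rewrite (@iter_zw_mul_map _ _ _ (fun b c f => zsign R (d pA b * d pB (is_Om u)) *:
     gcomm (d pB (is_Om u)) (d pA b + d pC c) (B u) f)).
    by rewrite hAC gcomm0r scaler0.
  by move=> *; rewrite gcommBr scalerBr.
have TE : zw_mul3 i = fun g => zx_mul i g + xw_mul i g by apply/funext => g; exact: zw_mul3E.
have T3 : iter (3 * r) (zw_mul3 i) F = 0.
  rewrite TE; apply: (iter_dong (zx_mulD i) (xw_mulD i) (zx_xwC i i) FGH G0 F0).
  by rewrite -TE.
pose Fk := foldr (fun j g => iter (k j) (xw_mul j) g) F (enum 'I_n).
have Fk0 : iter (3 * r) (zw_mul3 i) Fk = 0.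
  rewrite /Fk; elim: (enum 'I_n) => //= j s IH.
  rewrite (@iter_comm _ (zw_mul3 i) (iter (k j) (xw_mul j))).
    by rewrite IH (iter_zero _ (xw_mulD j)).
  by move=> f; rewrite (iter_comm _ _ (fun g => esym (zw_xwC i j g))).
have cE : ccomm pA (pB + pC - N) A (kprod N pB pC k B C) =
    fun x y => sym_sign pB true (is_Om y) *: Fk x (Om 0) y.
  apply/funext => x; apply/funext => y; rewrite /Fk -zw_mpow_xw.
  rewrite (@zw_mpow_map _ _ _ _
    (fun b c f => gcomm (d pA (is_Om x)) (d pB b + d pC c) (A x) f));
    last by move=> *; exact: gcommBr.
  rewrite /ccomm /kprod /Res_z field_comm_ccomm.
  rewrite (@zw_mpow_map _ _ _ _ (fun b c f => sym_sign pB b c *: f)); last first.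
    by move=> *; rewrite scalerBr.
  rewrite gcommZr; congr (_ *: gcomm _ _ _ _).
  by rewrite /d /nOm mulr1 [RHS]addrACA -opprD opprD addrA.
rewrite cE (@iter_zw_mul_map _ _ _ (fun b c f => sym_sign pB true c *: f)); last first.
  by move=> *; rewrite scalerBr.
by apply/funext => x; apply/funext => y; rewrite -iter_zw3 Fk0 scaler0.
Qed.

End Dong.

(** * Derivatives of the delta distribution *)
Section Binomials.
Variable n : nat.
Implicit Types (i : 'I_n) (j k m : multi n).

Lemma mi_binom_small k m : ~~ mi_le m k -> mi_binom k m = 0%N.
Proof.
move=> /mi_leNP[i hi]; rewrite /mi_binom (bigD1 i) //=.
by rewrite bin_small.
Qed.

Lemma mi_binom0 k : mi_binom k 0 = 1%N.
Proof. by rewrite /mi_binom big1 // => i _; rewrite mi0 bin0. Qed.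

Lemma mi_unitN i (l : 'I_n) : l != i -> mi_unit i l = 0%N.
Proof. by rewrite mi1 => /negbTE ->. Qed.

Lemma mi_binom_pascal i k m :
  mi_binom (k + mi_unit i) (m + mi_unit i) =
  (mi_binom k (m + mi_unit i)%R + mi_binom k m)%N.
Proof.
rewrite /mi_binom !(bigD1 i (P := xpredT)) //= !miE eqxx !addn1 binS mulnDl.
by congr (_ * _ + _ * _)%N; apply: eq_bigr => l li;
  rewrite !miD (mi_unitN li) ?addn0.
Qed.

Lemma mi_binom_indep i k m : m i = 0%N -> mi_binom (k + mi_unit i) m = mi_binom k m.
Proof.
move=> mi; apply: eq_bigr => l _; rewrite miD mi1.
by case: eqP => [->|_]; rewrite ?addn0 // mi !bin0.
Qed.

Lemma mi_absD j k : mi_abs (j + k) = (mi_abs j + mi_abs k)%N.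
Proof. by rewrite /mi_abs -big_split; apply: eq_bigr => i _; rewrite miD. Qed.

Lemma mi_abs_unit i : mi_abs (mi_unit i) = 1%N.
Proof.
rewrite /mi_abs (bigD1 i) //= mi1 eqxx big1 // => l li; exact: mi_unitN.
Qed.

End Binomials.

Section DeltaCalculus.
Variables (R : comPzRingType) (n : nat) (N : int) (E : lmodType R).
Implicit Types (x y : mono n) (i : 'I_n) (j k l m r : multi n) (g : K1 n E).

(** As a series in [z] the derivative of order [m] of [Delta] has very simple
    coefficients: at each monomial [x] a scalar [dcoef m x] times a single
    monomial [dmono m x] in [w]. *)
Definition dcoef m x : R :=
  match x with
  | Om j => (mi_binom j m)%:R
  | Pow j => zsign R N * (-1) ^+ mi_abs m * (mi_binom (j + m) m)%:R
  end.

Definition dmono m x : mono n :=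
  match x with Om j => Pow (mi_sub j m) | Pow j => Om (j + m) end.

Lemma dDelta_mulE m g x y :
  dDelta_mul N m g x y = dcoef m x *: oapp g 0 (mono_div y (dmono m x)).
Proof.
rewrite /dDelta_mul (@series_mulE _ _ _ _ _ _ _ _ _ _ _ _ [:: (x, dmono m x)]) //.
  rewrite big_seq1 /= mono_divv; case e: mono_div => [w|] /=; last by rewrite scaler0.
  rewrite /in_w eqxx zsign0; last first.
    by rewrite ?parE /=; case: x {e} => j /=; rewrite ?andbF ?andbT /= addbb.
  rewrite scale1r; congr (_ *: _); rewrite /hasse_w /dcoef; case: x {e} => j /=.
    rewrite (_ : mi_sub _ _ = j) ?eqxx; last by rewrite addrC mi_subDl.
    by rewrite mulr1 mulrC mulr_natr.
  case: (boolP (mi_le m j)) => [/mi_subK h|h]; last first.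
    rewrite (mi_binom_small h) (_ : (j == _) = false) ?mul0rn //.
    by apply: contraNF h => /eqP ->; apply/mi_leP => i; rewrite !miE; lia.
  by rewrite addrC h eqxx.
move=> [a a'] [b b'] /=; rewrite /in_w inE xpair_eqE.
case: (b =P _) => [->|_]; last by rewrite scaler0.
move=> + /mono_mul1 e _; rewrite {}e eqxx /= => h.
rewrite (_ : hasse_w _ _ _ _ = 0) ?scale0r //.
case: x h => j; case: a' => k //= h; rewrite ?mulr0 ?mul0rn //.
- case: eqP => [e|_]; last by rewrite mulr0 mulr0 mul0rn.
  rewrite mi_binom_small //; apply: contra h => /mi_subK h.
  by rewrite e addrC h.
- case: eqP => [e|_]; last by rewrite mul0rn.
  by move: h; rewrite e addrC mi_subDl eqxx.
Qed.

Lemma dDelta_mul0 m : dDelta_mul N m (0 : K1 n E) = 0.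
Proof.
apply/funext => x; apply/funext => y; rewrite dDelta_mulE.
by case: mono_div => [q|]; exact: scaler0.
Qed.

Lemma zw_mul_dDeltaE i m g x y :
  zw_mul i (dDelta_mul N m g) x y =
  shift i (fun a => dcoef m a *: oapp g 0 (mono_div y (dmono m a))) x
  - dcoef m x *: oapp g 0 (obind (mono_div^~ (dmono m x)) (mono_div y (mono_var i))).
Proof.
rewrite /zw_mul /shift; congr (_ - _).
  by case: mono_div => //= q; rewrite dDelta_mulE.
by case: mono_div => [q|] /=; rewrite ?scaler0 // dDelta_mulE.
Qed.

(** Multiplication by [z_i - w_i] lowers the order of the derivative by one.
    On coefficients this is the Pascal rule. *)
Lemma zw_mul_dDeltaS i m g :
  zw_mul i (dDelta_mul N (m + mi_unit i) g) = dDelta_mul N m g.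
Proof.
apply/funext => x; apply/funext => y; rewrite zw_mul_dDeltaE dDelta_mulE.
case: x => k; rewrite /shift [mono_div _ (mono_var i)]/mono_div.
- have -> : oapp g 0 (obind (mono_div^~ (dmono (m + mi_unit i) (Pow k)))
      (mono_div y (mono_var i)))
    = oapp g 0 (mono_div y (Om (k + m))).
    congr oapp; case: y => l; rewrite /mono_div /=; first by case: ifP.
    have -> : mi_le (l + mi_unit i) (k + (m + mi_unit i)) = mi_le l (k + m).
      by apply/mi_leP/mi_leP => h a; move: (h a); rewrite !miE; lia.
    by case: ifP => // _; congr (Some (Pow _)); apply/mi_ext => a; rewrite !miE; lia.
  set G := oapp g 0 _.
  have -> : oapp (fun a => dcoef (m + mi_unit i) a *:
        oapp g 0 (mono_div y (dmono (m + mi_unit i) a))) 0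
      (if mi_le (mi_unit i) k then Some (Pow (mi_sub k (mi_unit i))) else None)
      = (zsign R N * (-1) ^+ mi_abs (m + mi_unit i)
          * (mi_binom (k + m) (m + mi_unit i))%:R) *: G.
    case: ifP => [/mi_subK h|/negbT/mi_leNP[a ha]] /=; last first.
      rewrite mi_binom_small ?mulr0 ?scale0r //; apply/mi_leNP; exists i.
      move: ha; rewrite !miE eqxx; case: eqP => [->|_]; lia.
    have -> : mi_sub k (mi_unit i) + (m + mi_unit i) = k + m.
      by rewrite [m + _]addrC addrA [_ + mi_unit i]addrC h.
    by [].
  rewrite -scalerBl -mulrBr /dcoef /= -/G; congr (_ *: _).
  rewrite addrA mi_binom_pascal natrD opprD addNKr mi_absD mi_abs_unit addn1 exprS.
  by rewrite mulN1r !mulrN mulNr opprK.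
rewrite /= (_ : mi_sub _ _ = mi_sub k m); last first.
  by apply/mi_ext => a; rewrite !miE; lia.
case: (boolP (mi_le (m + mi_unit i) k)) => [/mi_leP h|h].
  rewrite mono_divD (_ : mi_unit i + _ = mi_sub k m); last first.
    by apply/mi_ext => a; move: (h a); rewrite !miE; lia.
  by rewrite -scalerBl mi_binom_pascal natrD addrC addKr.
by rewrite mi_binom_pascal (mi_binom_small h) scale0r subr0.
Qed.

Lemma zw_mul_dDelta0 i m g : m i = 0%N -> zw_mul i (dDelta_mul N m g) = 0.
Proof.
move=> mi; apply/funext => x; apply/funext => y; rewrite zw_mul_dDeltaE.
apply/eqP; rewrite -[0 x y]/(0 : E) subr_eq0; apply/eqP.
case: x => k; rewrite /shift [mono_div _ (mono_var i)]/mono_div /=; last first.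
  rewrite mi_binom_indep // mono_divD; congr (_ *: oapp g 0 (mono_div y (Pow _))).
  apply/mi_ext => a; rewrite !miE; case: eqP => [->|]; lia.
case: ifP => [hk|/negbT/mi_leNP[a ha]] /=.
  have e : k + m = mi_sub k (mi_unit i) + m + mi_unit i.
    by rewrite addrAC [_ + mi_unit i]addrC mi_subK.
  rewrite e (mi_binom_indep _ mi); congr (_ *: _); congr oapp.
  case: y => l; rewrite /mono_div /=; first by case: ifP.
  have -> : mi_le (l + mi_unit i) (mi_sub k (mi_unit i) + m + mi_unit i)
          = mi_le l (mi_sub k (mi_unit i) + m).
    by apply/mi_leP/mi_leP => h a; move: (h a); rewrite !miE; lia.
  by case: ifP => // _; congr (Some (Pow _)); apply/mi_ext => a; rewrite !miE; lia.
rewrite (_ : obind _ _ = None) ?scaler0 //.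
case: y => l; rewrite /mono_div /=; first by case: ifP.
rewrite ifF //; apply/negbTE/mi_leNP; exists i.
by move: ha; rewrite !miE mi eqxx; case: eqP => [->|_]; lia.
Qed.

Lemma iter_zw_mul_dDelta i (c : nat) m g :
  iter c (zw_mul i) (dDelta_mul N m g) =
  if (c <= m i)%N then dDelta_mul N [ffun l => if l == i then (m l - c)%N else m l] g
  else 0.
Proof.
elim: c => [|c IH] /=.
  apply: (congr1 (fun a => dDelta_mul N a g)); apply/mi_ext => l.
  by rewrite ffunE subn0 if_same.
rewrite {}IH; case: ltngtP => [h|h|e].
- rewrite -[RHS](zw_mul_dDeltaS i); apply: (congr1 (fun a => zw_mul i (dDelta_mul N a g))).
  apply/mi_ext => l; rewrite miD mi1 !ffunE; case: eqP => [->|]; lia.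
- exact: zw_mul0.
- by apply: zw_mul_dDelta0; rewrite ffunE eqxx e subnn.
Qed.

Lemma zw_mpow_dDelta j m g :
  zw_mpow N j (dDelta_mul N m g) =
  if mi_le j m then dDelta_mul N (mi_sub m j) g else 0.
Proof.
have E' (s : seq 'I_n) : uniq s ->
    foldr (fun i f => zw_pow N i (j i) f) (dDelta_mul N m g) s =
    if all (fun i => j i <= m i)%N s then
      dDelta_mul N [ffun l => if l \in s then (m l - j l)%N else m l] g else 0.
  elim: s => [|i s IH] /=.
    by move=> _; apply: (congr1 (fun a => dDelta_mul N a g)); apply/mi_ext => l; rewrite ffunE.
  case/andP=> nis us; rewrite zw_powE (IH us).
  case: (all _ s); last by rewrite andbF iter_zw_mul0.
  rewrite andbT iter_zw_mul_dDelta ffunE (negbTE nis); case: ifP => // _.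
  apply: (congr1 (fun a => dDelta_mul N a g)); apply/mi_ext => l; rewrite !ffunE inE.
  by case: eqP => [->|_] //=; rewrite (negbTE nis).
rewrite /zw_mpow E' ?enum_uniq //.
have -> : all (fun i => j i <= m i)%N (enum 'I_n) = mi_le j m.
  apply/allP/mi_leP => [h i|h i _ //]; apply: h; exact: mem_enum.
case: ifP => // _; apply: (congr1 (fun a => dDelta_mul N a g)); apply/mi_ext => l.
by rewrite ffunE miB mem_enum.
Qed.

(** The residues against powers of [z - w] are dual to the derivatives of
    [Delta], hence read off the coefficients of a local expansion. *)
Lemma Res_zw_mpow_dDelta j m g :
  Res_z (zw_mpow N j (dDelta_mul N m g)) = if j == m then g else 0.
Proof.
rewrite zw_mpow_dDelta; apply/funext => y; rewrite /Res_z.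
case: (eqVneq j m) => [->|jm].
  rewrite mi_le_refl dDelta_mulE /= (_ : mi_sub m m = 0); last first.
    by apply/mi_ext => i; rewrite !miE subnn.
  rewrite mi_binom0 scale1r (_ : mi_sub 0 0 = 0); last first.
    by apply/mi_ext => i; rewrite !miE.
  by rewrite -[Pow 0]/(one_mono n) mono_div1.
case: ifP => // /mi_leP h; rewrite dDelta_mulE /= mi_binom_small ?scale0r //.
apply: contra jm => /mi_leP h'; apply/eqP/mi_ext => i.
by move: (h i) (h' i); rewrite !miE; lia.
Qed.

Definition mi_lts r : set (multi n) := [set m | forall i, (m i < r i)%N].

Lemma finite_mi_lts r : finite_set (mi_lts r).
Proof.
apply: sub_finite_set (finite_box r) => m /= h; apply/mi_leP => i; exact: ltnW.
Qed.

Lemma Res_zw_mpow_sum r j (g : multi n -> K1 n E) :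
  Res_z (zw_mpow N j (\sum_(m \in mi_lts r) dDelta_mul N m (g m))) =
  if j \in mi_lts r then g j else 0.
Proof.
rewrite fsbig_finite; last exact: finite_mi_lts.
rewrite (big_morph (zw_mpow N j) (zw_mpowD N j) (zw_mpow0 N E j)).
rewrite (big_morph (@Res_z n E) (id1 := 0) (op1 := +%R)) //.
rewrite (eq_bigr _ (fun m _ => Res_zw_mpow_dDelta j m (g m))).
rewrite -(in_fset_set (finite_mi_lts r)); case: ifP => h.
  rewrite (bigD1_seq j) ?finmap.fset_uniq //= eqxx big1 ?addr0 // => m.
  by rewrite eq_sym => /negbTE ->.
rewrite big1_seq // => m /= mS; case: eqP => // e.
by move: h; rewrite e mS.
Qed.

Lemma is_local_sum r (g : multi n -> K1 n E) :
  is_local N (\sum_(m \in mi_lts r) dDelta_mul N m (g m)).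
Proof.
(* The terms with some [j_i = r_i] vanish; the bound [r] rather than [r - 1]
   also covers an [r] with zero entries. *)
exists r; set f := (X in X = _).
rewrite (eq_fsbigr (fun j => dDelta_mul N j (if j \in mi_lts r then g j else 0))); last first.
  by move=> j _; rewrite Res_zw_mpow_sum.
rewrite -(@fsbig_widen _ _ _ _ (mi_lts r)) /=.
- by apply: eq_fsbigr => j ->.
- by move=> m /= h; apply/mi_leP => i; exact: ltnW.
- move=> j [_ /= nj]; rewrite memNset //; exact: dDelta_mul0.
Qed.

End DeltaCalculus.

(** * The normally ordered product and its commutators *)
Section NormalOrder.
Variables (R : comPzRingType) (n : nat) (N : int) (V : lmodType R).
Implicit Types (x y u w : mono n) (i : 'I_n) (j k l m r : multi n).
Implicit Types (A B C D E : K1 n (End V)) (v : V) (p q : int).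

Lemma msum_scale (c : R) (F : multi n -> V) : bounded F ->
  c *: msum F = msum (fun l => c *: F l).
Proof. by move=> bF; rewrite -(msum_lin (c \*: (idfun : V -> V))). Qed.

Lemma bounded_scale (c : R) (F : multi n -> V) : bounded F ->
  bounded (fun l => c *: F l).
Proof. by move=> bF; apply: (bounded_lin (f := *:%R c)) bF; exact: scaler0. Qed.

Lemma coh_kprod p q k A B : coh_field A -> coh_field B ->
  coh_field (kprod N p q k A B).
Proof.
move=> cA cB.
pose S (f : K2 n (End V)) := forall j v, exists K, forall l,
  ~~ mi_le l K -> f (Om j) (Om l) v = 0.
have Szw i f : S f -> S (zw_mul i f).
  move=> Sf j v; have [K1 h1] := Sf (j + mi_unit i) v; have [K2 h2] := Sf j v.
  exists (mi_max K1 K2) => l hl.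
  rewrite -[LHS]/(f (Om (j + mi_unit i)) (Om l) v - f (Om j) (Om (l + mi_unit i)) v).
  rewrite h1 ?h2 ?subr0 //; apply: contra hl => hl.
    by apply: mi_le_trans (mi_le_trans (mi_le_addr _ _) hl) (mi_le_maxr _ _).
  by apply: mi_le_trans hl (mi_le_maxl _ _).
have Sp : S (zw_mpow N k (field_comm N p q A B)).
  rewrite /zw_mpow; elim: (enum 'I_n) => [|i s IH] /=; last first.
    rewrite zw_powE; elim: (k i) => //= c; exact: Szw.
  move=> j v; have [K1 h1] := cB v; have [K2 h2] := cB (A (Om j) v).
  exists (mi_max K1 K2) => l hl.
  rewrite field_commE -[LHS]/(_ *: gcomm _ _ _ _ v) gcommE h1 ?h2.
  - by rewrite linear0 scaler0 subr0 scaler0.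
  - by apply: contra hl => hl; apply: mi_le_trans hl (mi_le_maxr _ _).
  - by apply: contra hl => hl; apply: mi_le_trans hl (mi_le_maxl _ _).
by move=> v; exact: Sp.
Qed.

(** The product of the part of [B] without [Omega] and of [C]: the terms of the
    coefficient of [y] are indexed by the exponent of the monomial taken from
    [B]. For [y] with an [Omega] the sum is infinite, but finite on each
    vector. *)
Definition conv_term B C y l : End V :=
  oapp (fun w => end_comp (B (Pow l)) (C w)) 0 (mono_div y (Pow l)).

Definition conv B C : K1 n (End V) := fun y => end_sum setT (conv_term B C y).

Lemma bounded_conv_term B C y v : coh_field C ->
  bounded (fun l => conv_term B C y l v).
Proof.
move=> cC; case: y => k.
  by exists k => l h; rewrite /conv_term /mono_div (negbTE h).
have [K hK] := cC v; exists K => l h.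
rewrite /conv_term /mono_div /= hK ?linear0 //.
apply: contra h => /mi_leP h; apply/mi_leP => i; move: (h i); rewrite !miE; lia.
Qed.

Lemma convE B C y v : coh_field C ->
  conv B C y v = msum (fun l => conv_term B C y l v).
Proof.
move=> cC; rewrite /conv end_sumE // => {}v.
have [K hK] := bounded_conv_term B y v cC.
apply: sub_finite_set (finite_box K) => l [_ /= h].
by apply: contraNT h => /hK ->.
Qed.

Lemma coh_conv B C v : coh_field C ->
  exists K, forall k, ~~ mi_le k K -> conv B C (Om k) v = 0.
Proof.
move=> cC; have [K hK] := cC v; exists K => k h; rewrite convE // -[RHS](@msum0 n).
apply: eq_msum => l; rewrite /conv_term /mono_div /= hK ?linear0 //.
by apply: contra h; apply: mi_le_trans; exact: mi_le_addr.
Qed.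

Lemma nop2_Pow p q B C l u : nop2 N p q B C (Pow l) u =
  zsign R (p * N * nOm u) *: end_comp (B (Pow l)) (C u).
Proof.
rewrite -[LHS]/(prod_zw N p (plus_part B) C (Pow l) u
  + zsign R (p * q) *: prod_wz N q C (minus_part B) (Pow l) u).
rewrite prod_zwE prod_wzE /= /plus_part /minus_part /= end_comp0r !scaler0 addr0.
by rewrite {1}/nOm /= mulr0 subr0.
Qed.

Lemma nop2_Om p q B C j l : nop2 N p q B C (Om j) (Pow l) =
  zsign R (p * q + q * N) *: end_comp (C (Pow l)) (B (Om j)).
Proof.
rewrite -[LHS]/(prod_zw N p (plus_part B) C (Om j) (Pow l)
  + zsign R (p * q) *: prod_wz N q C (minus_part B) (Om j) (Pow l)).
rewrite prod_zwE prod_wzE /= /plus_part /minus_part /= end_comp0l !scaler0 add0r.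
by rewrite scalerA; congr (_ *: _); zsign_tac.
Qed.

(** Both halves of the normally ordered product are of the same form. In the
    second one [B] contributes an [Omega] and thus [C] a plain power, so it is
    the part with [Omega] of the product with [B] and [C] exchanged. *)
Lemma nopE p q B C y : coh_field B -> coh_field C ->
  nop N p q B C y = zsign R (p * N * nOm y) *: conv B C y
    + (if is_Om y then zsign R (p * q + q * N) *: conv C B y else 0).
Proof.
move=> cB cC; rewrite /nop /restrict_diag.
set S := [set q | _]; set F := (X in end_sum _ X).
pose h1 l := (Pow l, odflt y (mono_div y (Pow l))).
pose h2 l := (odflt y (mono_div y (Pow l)), Pow l).
have fins v : exists D : set (multi n), [/\ finite_set D,
    (forall l, D l -> isSome (mono_div y (Pow l))),
    (forall l, ~ D l -> conv_term B C y l v = 0 /\ conv_term C B y l v = 0) &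
    forall t, S t -> ~ ((h1 @` D) `|` (if is_Om y then h2 @` D else set0)) t -> F t v = 0].
  have [K1 hK1] := bounded_conv_term B y v cC.
  have [K2 hK2] := bounded_conv_term C y v cB.
  pose K := mi_max K1 K2; pose D := [set l | mi_le l K /\ mono_div y (Pow l)].
  have D0 l : ~ D l -> conv_term B C y l v = 0 /\ conv_term C B y l v = 0.
    case: (boolP (mono_div y (Pow l))) => hd nD; last first.
      by rewrite /conv_term; case: mono_div hd.
    have nl : ~~ mi_le l K by apply/negP => hl; apply: nD.
    split; [apply: hK1|apply: hK2]; apply: contra nl => /mi_le_trans; apply.
      exact: mi_le_maxl.
    exact: mi_le_maxr.
  exists D; split=> // [|l [] //|[[l|j] w]].
  - by apply: sub_finite_set (finite_box K) => l [].
  - move=> Sw nq; rewrite -[F _]/(nop2 N p q B C (Pow l) w) nop2_Pow.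
    have hw := (mono_divP (Pow l) w y).1 Sw.
    have : ~ D l by move=> Dl; apply: nq; left; exists l => //; rewrite /h1 hw.
    case/D0; rewrite /conv_term hw /= => e _.
    by rewrite -[LHS]/(_ *: _) e scaler0.
  case: w => [l|w] // Sw nq; rewrite -[F _]/(nop2 N p q B C (Om j) (Pow l)) nop2_Om.
  have hw := (mono_divP (Pow l) (Om j) y).1 (etrans (mono_mulC _ _) Sw).
  have : ~ D l.
    move=> Dl; apply: nq; right; rewrite -(is_Om_div_Pow hw) /=.
    by exists l => //; rewrite /h2 hw.
  case/D0; rewrite /conv_term hw /= => _ e.
  by rewrite -[LHS]/(_ *: _) e scaler0.
have finU (D : set (multi n)) : finite_set D ->
    finite_set ((h1 @` D) `|` (if is_Om y then h2 @` D else set0)).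
  move=> fD; rewrite finite_setU; split; first exact: finite_image.
  by case: is_Om => //; exact: finite_image.
apply: endP => v; rewrite end_sumE; last first.
  move=> {}v; have [D [fD _ _ out]] := fins v.
  apply: sub_finite_set (finU D fD) => t [St /= nz]; apply: contrapT => nt.
  by move/eqP: nz; apply; exact: out.
have [D [fD Dd D0 out]] := fins v.
have toD (c : R) (B' C' : K1 n (End V)) : (forall l, ~ D l -> conv_term B' C' y l v = 0) ->
    coh_field C' -> c *: conv B' C' y v = \sum_(l \in D) c *: conv_term B' C' y l v.
  move=> h cC'; rewrite convE //.
  rewrite msum_scale; last exact: bounded_conv_term.
  symmetry; apply: fsbig_widen => // l [_ nD] /=; by rewrite h // scaler0.
rewrite -[RHS]/(_ *: conv B C y v + _) (toD _ B C) //; last by move=> l /D0[].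
transitivity (\sum_(t \in (h1 @` D) `|` (if is_Om y then h2 @` D else set0)) F t v).
  symmetry; apply: fsbig_widen => [t|t [St nt]]; last exact: out.
  case=> [[l /Dd hl <-]|].
    rewrite /S /h1; case e: (mono_div y (Pow l)) hl => [w|//] _.
    exact: ((mono_divP (Pow l) w y).2 e).
  case: ifP => // _ [l /Dd hl <-].
  rewrite /S /h2; case e: (mono_div y (Pow l)) hl => [w|//] _.
  exact: (etrans (mono_mulC w (Pow l)) ((mono_divP (Pow l) w y).2 e)).
rewrite fsbigU; first 1 last.
- exact: finite_image.
- by case: is_Om => //; exact: finite_image.
- move=> t [[l _ <-]]; case: ifP => // yOm [l' /Dd hl'].
  move/(congr1 (fun t : mono n * mono n => is_Om t.1)).
  rewrite /h1 /h2 /=; case e: mono_div hl' => [q'|] //= _.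
  by rewrite (is_Om_div_Pow e) yOm.
congr (_ + _).
  rewrite fsbig_image; last by move=> l l' _ _ [].
  apply: eq_fsbigr => l; rewrite inE => /Dd hl.
  rewrite -[F _]/(nop2 N p q B C (Pow l) (odflt y (mono_div y (Pow l)))) nop2_Pow.
  rewrite /conv_term; case e: mono_div hl => [q'|] //= _.
  by rewrite /nOm (is_Om_div_Pow e).
case: ifP => yOm; last exact: fsbig_set0.
rewrite fsbig_image; last by move=> l l' _ _ [].
rewrite -[RHS]/(_ *: conv C B y v) (toD _ C B) //; last by move=> l /D0[].
apply: eq_fsbigr => l; rewrite inE => /Dd hl.
rewrite -[F _]/(nop2 N p q B C (odflt y (mono_div y (Pow l))) (Pow l)) /conv_term.
case e: mono_div hl => [q'|//] _; rewrite [odflt _ _]/=.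
by move: (is_Om_div_Pow e); rewrite yOm; case: q' {e} => // j _; rewrite nop2_Om.
Qed.

Lemma coh_nop p q B C : coh_field B -> coh_field C -> coh_field (nop N p q B C).
Proof.
move=> cB cC v; have [K1 h1] := coh_conv B v cC; have [K2 h2] := coh_conv C v cB.
exists (mi_max K1 K2) => k hk; rewrite nopE //= -[LHS]/(_ *: conv B C _ v + _ *: conv C B _ v).
rewrite h1 ?h2 ?scaler0 ?addr0 //; apply: contra hk => /mi_le_trans; apply.
  exact: mi_le_maxr.
exact: mi_le_maxl.
Qed.

Lemma end_bigE (I : Type) (s : seq I) (F : I -> End V) v :
  (\sum_(i <- s) F i) v = \sum_(i <- s) F i v.
Proof. by apply: (big_morph (fun f : End V => f v)). Qed.

Lemma end_comp_suml (I : Type) (s : seq I) (F : I -> End V) (g : End V) :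
  end_comp (\sum_(i <- s) F i) g = \sum_(i <- s) end_comp (F i) g.
Proof.
apply: (big_morph (fun f : End V => end_comp f g)) => [f h|]; first exact: end_compDl.
exact: end_comp0l.
Qed.

Lemma end_comp_sumr (I : Type) (s : seq I) (F : I -> End V) (g : End V) :
  end_comp g (\sum_(i <- s) F i) = \sum_(i <- s) end_comp g (F i).
Proof.
apply: (big_morph (fun f : End V => end_comp g f)) => [f h|]; first exact: end_compDr.
exact: end_comp0r.
Qed.

Lemma gcomm_msum a b f (phi : End V) (F : multi n -> End V) v :
  (forall v, bounded (fun l => F l v)) ->
  (forall v, phi v = msum (fun l => F l v)) ->
  gcomm a b f phi v = msum (fun l => gcomm a b f (F l) v).
Proof.
move=> bF phiE; rewrite gcommE !phiE (msum_lin f) //.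
rewrite -scaleNr msum_scale //.
rewrite -msumD; first by apply: eq_msum => l; rewrite gcommE /= scaleNr.
  by apply: (bounded_lin (f := f)) (bF v); exact: linear0.
exact: bounded_scale (bF (f v)).
Qed.

Section Derivation.
Variables (a b d : int) (f : End V) (s : seq (multi n)) (c : multi n -> R).
Variables (mu : multi n -> mono n) (D E : multi n -> K1 n (End V)).
Variables (B C : K1 n (End V)) (y : mono n) (sg : R).
Hypotheses (cC : coh_field C) (cE : forall m, coh_field (E m)).
Hypothesis hB : forall l, gcomm a b f (B (Pow l)) =
  \sum_(m <- s) c m *: oapp (D m) 0 (mono_div (Pow l) (mu m)).
Hypothesis hC : forall w, is_Om w = is_Om y -> gcomm a d f (C w) =
  sg *: \sum_(m <- s) c m *: oapp (E m) 0 (mono_div w (mu m)).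

Definition left_part m : End V :=
  if mu m is Pow _ then oapp (conv (D m) C) 0 (mono_div y (mu m)) else 0.

Let left_term m l : End V :=
  oapp (fun w => end_comp (oapp (D m) 0 (mono_div (Pow l) (mu m))) (C w)) 0
    (mono_div y (Pow l)).

Let right_term m l : End V := oapp (fun y' => conv_term B (E m) y' l) 0 (mono_div y (mu m)).

Lemma left_termE m v :
  bounded (fun l => left_term m l v) /\
  msum (fun l => left_term m l v) = left_part m v.
Proof.
rewrite /left_term /left_part; case: (mu m) => j; last first.
  have E0 : (fun l => (oapp (fun w =>
     end_comp (oapp (D m) 0 (mono_div (Pow l) (Om j))) (C w)) 0
     (mono_div y (Pow l)) : End V) v) = fun=> 0.
    apply/funext => l; rewrite /(mono_div _ (Om j)).
    by case: mono_div => //= w; rewrite end_comp0l.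
  by rewrite E0; split; [exact: bounded0 | exact: msum0].
pose F l := (oapp (fun y' => conv_term (D m) C y' l) 0 (mono_div y (Pow j)) : End V) v.
have E0 : (fun l => (oapp (fun w =>
     end_comp (oapp (D m) 0 (mono_div (Pow l) (Pow j))) (C w)) 0
     (mono_div y (Pow l)) : End V) v) = fun l => if mi_le j l then F (mi_sub l j) else 0.
  apply/funext => l; rewrite /F [mono_div (Pow l) _]/mono_div /conv_term.
  case: ifP => [/mi_subK h|_] /=; last by case: mono_div => //= w; rewrite end_comp0l.
  rewrite -{2}h -mono_divD; case: (mono_div y (Pow j)) => //=.
have bF : bounded F.
  rewrite /F; case: mono_div => [y'|] /=; last exact: bounded0.
  exact: bounded_conv_term.
rewrite E0; split; first exact: bounded_shift.
rewrite msum_shift /F; case: mono_div => [y'|] /=; last exact: msum0.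
by rewrite convE.
Qed.

Lemma right_termE m v :
  bounded (fun l => right_term m l v) /\
  msum (fun l => right_term m l v) =
    (oapp (conv B (E m)) 0 (mono_div y (mu m)) : End V) v.
Proof.
rewrite /right_term; case: mono_div => [y'|] /=; last first.
  by split; [exact: bounded0 | exact: msum0].
by split; [exact: bounded_conv_term | rewrite convE].
Qed.

(** A graded commutator is a derivation. A multiplication by a monomial can be
    moved out of the right factor always, but out of the left one only if it is
    a plain power: a multiple of an [Omega] has no part without [Omega], the
    only part of the left factor that is used, so there the term disappears. *)
Lemma gcomm_conv :
  gcomm a (b + d) f (conv B C y) =
  \sum_(m <- s) c m *: (left_part m +
    (zsign R (a * b) * sg) *: oapp (conv B (E m)) 0 (mono_div y (mu m))).
Proof.
set sc := zsign R (a * b) * sg; apply: endP => v; rewrite end_bigE.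
rewrite (@gcomm_msum _ _ _ _ (conv_term B C y)); first last.
- by move=> {}v; rewrite convE.
- by move=> {}v; exact: bounded_conv_term.
have bT m : bounded (fun l => c m *: (left_term m l v + sc *: right_term m l v)).
  apply/bounded_scale/boundedD; first by case: (left_termE m v).
  by apply: bounded_scale; case: (right_termE m v).
transitivity (msum (fun l => \sum_(m <- s) c m *: (left_term m l v + sc *: right_term m l v))).
  apply: eq_msum => l.
  transitivity ((\sum_(m <- s) c m *: (left_term m l + sc *: right_term m l)) v);
    last by rewrite end_bigE.
  apply: (congr1 (fun h : End V => h v)).
  have e2 m : right_term m l = oapp (fun w =>
      end_comp (B (Pow l)) (oapp (E m) 0 (mono_div w (mu m)))) 0
      (mono_div y (Pow l)).
    rewrite /right_term /conv_term; have := mono_divC y l (mu m).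
    case: (mono_div y (mu m)) => [q|]; case: (mono_div y (Pow l)) => [q'|] //=.
    - by move=> ->; case: mono_div => //=; rewrite end_comp0r.
    - by move=> <-.
    - by move=> ->; rewrite /= end_comp0r.
  rewrite /conv_term; case e: (mono_div y (Pow l)) => [w|] /=; last first.
    rewrite gcomm0r big1 // => m _; rewrite e2 /left_term e /=.
    by rewrite !scaler0 addr0 scaler0.
  rewrite gcomm_comp hB hC ?(is_Om_div_Pow e) // end_comp_suml end_compZr end_comp_sumr.
  rewrite scalerA scaler_sumr -big_split /=; apply: eq_bigr => m _.
  rewrite e2 /left_term e /= end_compZl end_compZr scalerDr !scalerA.
  by rewrite [c m * _]mulrC.
rewrite msum_sum //; apply: eq_bigr => m _.
have [b1 s1] := left_termE m v; have [b2 s2] := right_termE m v.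
have b2' : bounded (fun l => sc *: right_term m l v).
  exact: bounded_scale.
rewrite -[RHS]/(c m *: (left_part m v + sc *:
   (oapp (conv B (E m)) 0 (mono_div y (mu m)) : End V) v)).
rewrite -s1 -s2 msum_scale // -msumD //.
by rewrite msum_scale //; exact: boundedD.
Qed.

End Derivation.
End NormalOrder.

(** * The commutator with a normally ordered product *)
Section CommutatorNormalOrder.
Variables (R : comPzRingType) (n : nat) (N : int) (V : lmodType R).
Implicit Types (x y u w : mono n) (j k l m r : multi n).

(** A coefficient without [Omega] only involves coefficients of this kind of
    both factors. *)
Lemma conv_comm (a b : int) (C D : K1 n (End V)) k :
  coh_field C -> coh_field D ->
  (forall i j, gcomm a b (D (Pow i)) (C (Pow j)) = 0) ->
  conv C D (Pow k) = zsign R (a * b) *: conv D C (Pow k).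
Proof.
move=> cC cD h; apply: endP => v; rewrite -[RHS]/(_ *: conv D C (Pow k) v) !convE //.
rewrite msum_scale; last exact: bounded_conv_term.
pose F l := C (Pow (mi_sub k l)) (D (Pow l) v).
transitivity (msum (fun l => if mi_le l k then F (mi_sub k l) else 0)).
  apply: eq_msum => l; rewrite /conv_term /mono_div; case: ifP => //= /mi_leP lk.
  rewrite /F (_ : mi_sub k (mi_sub k l) = l) //.
  by apply/mi_ext => i; move: (lk i); rewrite !miE; lia.
rewrite msum_flip; apply: eq_msum => l.
rewrite /conv_term /mono_div; case: ifP => /= _; last by rewrite scaler0.
have /eqP := congr1 (fun f : End V => f v) (h l (mi_sub k l)).
rewrite gcommE -[(0 : End V) v]/(0 : V) subr_eq0 => /eqP ->.
by rewrite scalerA zsign_sqr scale1r.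
Qed.

Variables (pA pB pC : int) (A B C : K1 n (End V)) (s : seq (multi n)).
Variables (D E : multi n -> K1 n (End V)).
Hypotheses (cB : coh_field B) (cC : coh_field C).
Hypotheses (cD : forall m, coh_field (D m)) (cE : forall m, coh_field (E m)).
Hypothesis hAB : forall x u, ccomm N pA pB A B x u =
  sym_sign R N pA (is_Om x) (is_Om u) *:
  \sum_(m <- s) dcoef R N m x *: oapp (D m) 0 (mono_div u (dmono m x)).
Hypothesis hAC : forall x u, ccomm N pA pC A C x u =
  sym_sign R N pA (is_Om x) (is_Om u) *:
  \sum_(m <- s) dcoef R N m x *: oapp (E m) 0 (mono_div u (dmono m x)).
Hypothesis hDC : forall m i j,
  gcomm (pA + pB - N) pC (D m (Pow i)) (C (Pow j)) = 0.

Lemma gcomm_sum_Pow (q : int) (F : K1 n (End V)) (G : multi n -> K1 n (End V)) :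
  (forall x u, ccomm N pA q A F x u = sym_sign R N pA (is_Om x) (is_Om u) *:
     \sum_(m <- s) dcoef R N m x *: oapp (G m) 0 (mono_div u (dmono m x))) ->
  forall x l, gcomm (pA - N * nOm x) q (A x) (F (Pow l)) =
    \sum_(m <- s) dcoef R N m x *: oapp (G m) 0 (mono_div (Pow l) (dmono m x)).
Proof.
move=> h x l; have := h x (Pow l); rewrite /ccomm /nOm /= mulr0 subr0 => ->.
by rewrite /sym_sign mulr0 scale1r.
Qed.

Lemma gcomm_sum_type (q : int) (F : K1 n (End V)) (G : multi n -> K1 n (End V)) :
  (forall x u, ccomm N pA q A F x u = sym_sign R N pA (is_Om x) (is_Om u) *:
     \sum_(m <- s) dcoef R N m x *: oapp (G m) 0 (mono_div u (dmono m x))) ->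
  forall x y w, is_Om w = is_Om y ->
  gcomm (pA - N * nOm x) (q - N * nOm y) (A x) (F w) =
    sym_sign R N pA (is_Om x) (is_Om y) *:
    \sum_(m <- s) dcoef R N m x *: oapp (G m) 0 (mono_div w (dmono m x)).
Proof. by move=> h x y w wy; rewrite -wy -h /ccomm /nOm wy. Qed.

(** At [x] without an [Omega] in [z] the commutator multiplies by an [Omega] in
    [w]. Then the term with [D] comes out of the second half of [:BC:], with the
    factors in the order [C D], and it takes [hDC] to bring them into the order
    [D C]. At [x] with an [Omega] the commutator multiplies by plain powers, and
    the four terms match one by one. *)
Lemma field_comm_nop x y :
  field_comm N pA (pB + pC) A (nop N pB pC B C) x y =
  \sum_(m <- s) dcoef R N m x *:
    oapp (nop N (pA + pB - N) pC (D m) C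
          + zsign R (pB * (pA + N)) *: nop N pB (pA + pC - N) B (E m)) 0
      (mono_div y (dmono m x)).
Proof.
rewrite field_commE nopE // gcommDr gcommZr.
have L1 := gcomm_conv cC cE (gcomm_sum_Pow hAB x) (gcomm_sum_type hAC x (y := y)).
have L2 := gcomm_conv cB cD (gcomm_sum_Pow hAC x) (gcomm_sum_type hAB x (y := y)).
rewrite -[pB + pC - _]addrA L1.
have -> : gcomm (pA - N * nOm x) (pB + (pC - N * nOm y)) (A x)
   (if is_Om y then zsign R (pB * pC + pC * N) *: conv C B y else 0) =
   if is_Om y then zsign R (pB * pC + pC * N) *:
     gcomm (pA - N * nOm x) (pC + (pB - N * nOm y)) (A x) (conv C B y) else 0.
  case: ifP => _; last exact: gcomm0r.
  by rewrite gcommZr addrCA.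
rewrite {}L2 {L1}.
have -> : (if is_Om y then zsign R (pB * pC + pC * N) *: \sum_(m <- s) dcoef R N m x *:
       (left_part (fun m => dmono m x) E B y m + (zsign R ((pA - N * nOm x) * pC) *
         sym_sign R N pA (is_Om x) (is_Om y)) *:
         oapp (conv C (D m)) 0 (mono_div y (dmono m x))) else 0) =
   \sum_(m <- s) dcoef R N m x *: (if is_Om y then zsign R (pB * pC + pC * N) *:
       (left_part (fun m => dmono m x) E B y m + (zsign R ((pA - N * nOm x) * pC) *
         sym_sign R N pA (is_Om x) (is_Om y)) *:
         oapp (conv C (D m)) 0 (mono_div y (dmono m x))) else 0).
  case: (is_Om y); last by rewrite big1 // => m _; rewrite scaler0.
  by rewrite scaler_sumr; apply: eq_bigr => m _; exact: end_scaleCA.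
rewrite scaler_sumr -big_split scaler_sumr; apply: eq_bigr => m _ /=.
rewrite [zsign R (pB * N * _) *: _]end_scaleCA -scalerDr end_scaleCA; congr (_ *: _).
rewrite /left_part; case: x => j /=.
  case: y => k; first by rewrite /mono_div /= !(scaler0, addr0).
  rewrite /mono_div /=; case: ifP => /= _; last by rewrite !(scaler0, addr0).
  rewrite -[RHS]/(nop _ _ _ (D m) C _ + _ *: nop _ _ _ B (E m) _) !nopE //= !addr0 !add0r.
  rewrite (conv_comm _ cC (cD m) (hDC m)) /sym_sign !(scalerDr, scalerA) addrC.
  by congr (_ *: _ + _ *: _); zsign_tac.
case e: mono_div => [q|] /=; last by rewrite !(scaler0, addr0, if_same).
rewrite -[RHS]/(nop _ _ _ (D m) C _ + _ *: nop _ _ _ B (E m) _) !nopE // (is_Om_div_Pow e).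
rewrite /nOm (is_Om_div_Pow e) /sym_sign /=; case: (is_Om y).
  rewrite !(scalerDr, scalerA) [X in _ + X = _]addrC addrACA.
  by congr (_ *: _ + _ *: _ + (_ *: _ + _ *: _)); zsign_tac.
rewrite !addr0 !(scalerDr, scalerA).
by congr (_ *: _ + _ *: _); zsign_tac.
Qed.

End CommutatorNormalOrder.

(** * Uniqueness of the expansion coefficients and the theorem *)
Section LocalExpansion.
Variables (R : comPzRingType) (n : nat) (N : int) (V : lmodType R).
Implicit Types (A B C : K1 n (End V)) (m r : multi n).

Lemma dDelta_sumE r (g : multi n -> K1 n (End V)) x y :
  (\sum_(m \in mi_lts r) dDelta_mul N m (g m)) x y =
  \sum_(m <- finmap.enum_fset (fset_set (mi_lts r)))
    dcoef R N m x *: oapp (g m) 0 (mono_div y (dmono m x)).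
Proof.
rewrite fsbig_finite; last exact: finite_mi_lts.
transitivity (\sum_(m <- finmap.enum_fset (fset_set (mi_lts r))) dDelta_mul N m (g m) x y).
  exact: (big_morph (fun f : K2 n (End V) => f x y)).
by apply: eq_bigr => m _; rewrite dDelta_mulE.
Qed.

Lemma ccomm_sum p q A B r (g : multi n -> K1 n (End V)) :
  field_comm N p q A B = \sum_(m \in mi_lts r) dDelta_mul N m (g m) ->
  forall x y, ccomm N p q A B x y = sym_sign R N p (is_Om x) (is_Om y) *:
    \sum_(m <- finmap.enum_fset (fset_set (mi_lts r)))
      dcoef R N m x *: oapp (g m) 0 (mono_div y (dmono m x)).
Proof.
move=> h x y; rewrite -dDelta_sumE -h field_comm_ccomm scalerA zsign_sqr.
by rewrite scale1r.
Qed.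

Lemma field_comm_kprod_sum p q A B r (g : multi n -> K1 n (End V)) :
  field_comm N p q A B = \sum_(m \in mi_lts r) dDelta_mul N m (g m) ->
  forall m, m \in mi_lts r -> g m = kprod N p q m A B.
Proof. by move=> h m mr; rewrite /kprod h Res_zw_mpow_sum mr. Qed.

(** By Dong's lemma for [C], [A], [B] the commutator of [A_(m)B] and [C] is
    killed by a power of [z_i - w_i], which is not a zero divisor on the part of
    the commutator without [Omega]. *)
Lemma gcomm_kprod_Pow pA pB pC A B C i a m j k :
  zw_pow N i a (field_comm N pA pB A B) = 0 ->
  zw_pow N i a (field_comm N pA pC A C) = 0 ->
  zw_pow N i a (field_comm N pB pC B C) = 0 ->
  gcomm (pA + pB - N) pC (kprod N pA pB m A B (Pow j)) (C (Pow k)) = 0.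
Proof.
move=> hAB hAC hBC.
have /zw_pow_comm_swap/zw_pow_commE/iter_zw_mul_PowPow/(_ j k) :=
  dong_commutator m (zw_pow_comm_swap hAC) (zw_pow_comm_swap hBC) hAB.
by rewrite /ccomm /nOm /= mulr0 !subr0.
Qed.

End LocalExpansion.

Theorem lemma2p3p7 (R : comPzRingType) (n : nat) (N : int) (hn : (0 < n)%N)
    (V : lmodType R) (G : grading V) (pA pB pC : int)
    (A B C : K1 n (End V))
    (hA : homog_field N G pA A) (hB : homog_field N G pB B)
    (hC : homog_field N G pC C)
    (r : multi n)
    (hAB : forall i, zw_pow N i (r i) (field_comm N pA pB A B) = 0)
    (hAC : forall i, zw_pow N i (r i) (field_comm N pA pC A C) = 0)
    (hBC : forall i, zw_pow N i (r i) (field_comm N pB pC B C) = 0) :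
  (forall (i : 'I_n) (k : multi n),
     zw_pow N i (3 * r i)
       (field_comm N pA (pB + pC - N) A (kprod N pB pC k B C)) = 0)
  /\
  (forall D E : multi n -> K1 n (End V),
     mutually_local N pA pB A B ->
     mutually_local N pA pC A C ->
     field_comm N pA pB A B =
       \sum_(m \in [set m : multi n | forall i, (m i < r i)%N])
         dDelta_mul N m (D m) ->
     field_comm N pA pC A C =
       \sum_(m \in [set m : multi n | forall i, (m i < r i)%N])
         dDelta_mul N m (E m) ->
     mutually_local N pA (pB + pC) A (nop N pB pC B C)
     /\
     field_comm N pA (pB + pC) A (nop N pB pC B C) =
       \sum_(m \in [set m : multi n | forall i, (m i < r i)%N])
         dDelta_mul N m
           (nop N (pA + pB - N) pC (D m) C
            + zsign R (pB * (pA + N)) *: nop N pB (pA + pC - N) B (E m))).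
Proof.
case: hA hB hC => [cA _] [cB _] [cC _].
split=> [i k|D E _ _]; first exact: dong_commutator.
rewrite -/(mi_lts r) => hD hE.
have DE := field_comm_kprod_sum hD; have EE := field_comm_kprod_sum hE.
have comm : field_comm N pA (pB + pC) A (nop N pB pC B C) =
    \sum_(m \in mi_lts r) dDelta_mul N m
      (nop N (pA + pB - N) pC (D m) C
       + zsign R (pB * (pA + N)) *: nop N pB (pA + pC - N) B (E m)).
  under eq_fsbigr => m mr do rewrite (DE m mr) (EE m mr).
  apply/funext => x; apply/funext => y; rewrite dDelta_sumE.
  apply: field_comm_nop => // [m|m|||m j k].
  - exact: coh_kprod.
  - exact: coh_kprod.
  - apply: ccomm_sum; rewrite hD; apply: eq_fsbigr => m mr; by rewrite (DE m mr).
  - apply: ccomm_sum; rewrite hE; apply: eq_fsbigr => m mr; by rewrite (EE m mr).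
  (* Since [n > 0] there is a variable to cancel. *)
  - by apply: (@gcomm_kprod_Pow _ _ _ _ _ _ _ _ _ _ (Ordinal hn)).
split=> //; split=> //; first exact: coh_nop.
by rewrite comm; exact: is_local_sum.
Qed.
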